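(* Let $K$ be a field, $S=K[x_1,\ldots,x_n]$, and let $I\subset S$ be a monomial ideal generated in degree $d$. Suppose that $I$ contains at least $n-1$ pure powers of the variables, say $x_1^d,\ldots,x_{n-1}^d\in I$. Let $\mathcal{P}(S)$ be the set of monomial prime ideals of $S$. The following conditions are equivalent: (a) $I$ is polymatroidal. (b) For all $P\in\mathcal{P}(S)$ the ideal $I(P)$ has a linear resolution. (c) The ideals $I$ and $I(P_{\{n\}})$ have a linear resolution. (d) $I=I_{(d;d,\ldots,d,k)}$ for some integer $k\geq 0$.
   Context: For a monomial ideal $I$, $G(I)$ denotes its unique minimal set of monomial generators, and $\deg_{x_i}(u)$ is the exponent of $x_i$ in the monomial $u$. $I$ is ''generated in degree $d$'' if all elements of $G(I)$ have degree $d$. A monomial ideal $I$ is polymatroidal if it is generated in a single degree and, for all $u,v\in G(I)$ and every $i$ with $\deg_{x_i}(u)>\deg_{x_i}(v)$, there exists $j$ with $\deg_{x_j}(u)<\deg_{x_j}(v)$ such that $x_j(u/x_i)\in I$. Monomial prime ideals are the ideals $P_C=(x_i : i\notin C)$ for $C\subseteq[n]=\{1,\ldots,n\}$; in particular $P_{\{n\}}=(x_1,\ldots,x_{n-1})$. The monomial localization $I(P_C)$ is the monomial ideal obtained from $I$ by substituting $x_i\mapsto 1$ for all $i\in C$. A graded ideal $L$ has a linear resolution if for some $e$ it has an $e$-linear resolution, i.e. $\mathrm{Tor}_i^S(L,K)_j=0$ for all $i$ and all $j\neq i+e$. For nonnegative integers $d,a_1,\ldots,a_n$, $I_{(d;a_1,\ldots,a_n)}\subset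 S$ is the monomial ideal generated by all monomials $u\in S$ of degree $d$ with $\deg_{x_i}(u)\leq a_i$ for $i=1,\ldots,n$ (ideal of Veronese type). In $I_{(d;d,\ldots,d,k)}$ the first $n-1$ bounds equal $d$ and the last bound equals $k$. *)

(* Defs.v *)
From HB Require Import structures.
From mathcomp Require Import all_boot all_order all_algebra.
From mathcomp Require Export mpoly.

Set Implicit Arguments.
Unset Strict Implicit.
Unset Printing Implicit Defensive.

Import GRing.Theory.
Local Open Scope ring_scope.

Section Ideals.
Variables (n : nat) (R : comNzRingType).
Implicit Types (I J : {mpoly R[n]} -> Prop) (u v : 'X_{1..n}).

(* Ideals are Prop-valued predicates and need not be proper, since I(P) can be
   the whole ring. *)
Definition ideal_span (A : {mpoly R[n]} -> Prop) : {mpoly R[n]} -> Prop :=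
  fun p => exists s : seq ({mpoly R[n]} * {mpoly R[n]}),
    (forall c, c \in s -> A c.2) /\ p = \sum_(c <- s) c.1 * c.2.

Definition eq_ideal I J := forall p, I p <-> J p.

Definition monomial_span (M : 'X_{1..n} -> Prop) : {mpoly R[n]} -> Prop :=
  ideal_span (fun p => exists2 u, M u & p = 'X_[u]).

Definition monomial_ideal I := exists M, eq_ideal I (monomial_span M).

(* The exponents of G(I): the monomials of I that are minimal for
   divisibility. *)
Definition min_gens I u :=
  I 'X_[u] /\ (forall v, I 'X_[v] -> (v <= u)%MM -> v = u).

Definition generated_in_degree I (d : nat) :=
  forall u, min_gens I u -> mdeg u = d.

Definition polymatroidal I :=
  [/\ monomial_ideal I,
      exists d, generated_in_degree I d
    & forall u v, min_gens I u -> min_gens I v ->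
      forall i : 'I_n, (v i < u i)%N ->
      exists2 j : 'I_n, (u j < v j)%N & I 'X_[(u - U_(i) + U_(j))%MM]].

(* I(P_C), taken as an ideal of the same polynomial ring; P_C is generated by
   the variables whose index is not in C. *)
Definition mon_loc I (C : {set 'I_n}) : {mpoly R[n]} -> Prop :=
  ideal_span (fun q => exists2 p, I p &
    q = p \mPo [tuple if i \in C then 1 else 'X_i | i < n]).

Definition veronese_type (d : nat) (a : 'I_n -> nat) : {mpoly R[n]} -> Prop :=
  monomial_span (fun u => mdeg u = d /\ forall i, (u i <= a i)%N).

End Ideals.

Section Tor.
Variables (n : nat) (K : fieldType) (L : {mpoly K[n]} -> Prop).
Local Notation S := {mpoly K[n]}.

(* A graded free resolution ... -> F_1 -> F_0 -> L -> 0 with each F_i of finite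
   rank and with basis elements of degrees gfr_deg i; the elements of F_i are
   row vectors, on which the maps act by right multiplication. *)
Record graded_free_resolution := GradedFreeResolution {
  gfr_rank : nat -> nat;
  gfr_deg : forall i, 'I_(gfr_rank i) -> nat;
  gfr_diff : forall i, 'M[S]_(gfr_rank i.+1, gfr_rank i);
  gfr_aug : 'cV[S]_(gfr_rank 0);
  gfr_diff_homog : forall i a b, gfr_diff i a b != 0 ->
    exists2 c, gfr_deg a = (gfr_deg b + c)%N & gfr_diff i a b \is c.-homog;
  gfr_aug_homog : forall a, gfr_aug a 0 \is (gfr_deg a).-homog;
  gfr_aug_image : forall p,
    L p <-> exists v : 'rV_(gfr_rank 0), p = (v *m gfr_aug) 0 0;
  gfr_exact0 : forall v : 'rV_(gfr_rank 0),
    v *m gfr_aug = 0 <-> exists w, v = w *m gfr_diff 0;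
  gfr_exactS : forall i (v : 'rV_(gfr_rank i.+1)),
    v *m gfr_diff i = 0 <-> exists w, v = w *m gfr_diff i.+1
}.

Variable F : graded_free_resolution.

(* The complex F (x)_S K, where K = S / (x_1, ..., x_n): its differentials are
   the matrices of constant coefficients. *)
Definition tensor_diff i : 'M[K]_(gfr_rank F i.+1, gfr_rank F i) :=
  map_mx (mcoeff 0%MM) (gfr_diff F i).

Definition tensor_diff_out i : 'M[K]_(gfr_rank F i, gfr_rank F i.-1) :=
  match i with 0 => 0 | i'.+1 => tensor_diff i' end.

Definition in_degree i (j : nat) (v : 'rV[K]_(gfr_rank F i)) :=
  forall a, @gfr_deg F i a != j -> v 0 a = 0.

(* Tor_i(L, K)_j = 0, Tor being the homology of F (x)_S K. *)
Definition Tor_eq0 i j := forall v : 'rV[K]_(gfr_rank F i),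
  in_degree j v -> v *m tensor_diff_out i = 0 ->
  exists2 w : 'rV[K]_(gfr_rank F i.+1), in_degree j w & v = w *m tensor_diff i.

End Tor.

(* Tor does not depend on the resolution used to compute it. *)
Definition linear_resolution n (K : fieldType) (L : {mpoly K[n]} -> Prop) :=
  exists (F : graded_free_resolution L) (e : nat),
    forall i j, j != (i + e)%N -> Tor_eq0 F i j.

(* Main.v *)
Require Import Defs.
From mathcomp Require Import all_boot all_order all_algebra.
From mathcomp Require Import zify.
From Stdlib Require Import Classical.

Set Implicit Arguments.
Unset Strict Implicit.
Unset Printing Implicit Defensive.

Import GRing.Theory.
Local Open Scope ring_scope.

(** The proof follows the circle (a), (b), (c), (d), (a), but (a) first yields (d):
    exchanging a generator v with the pure power x_i^d can only replace a variable
    of v by x_i, so from a generator with the largest exponent k of x_n all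
    monomials of degree d with exponent of x_n at most k are reached
    (polymatroidal_veronese).

    Every localization of I_(d; d, ..., d, k) is an ideal of the same form
    (veronese_localization), hence (b) follows if these ideals have linear
    resolutions. They are stable: if x_c is the last variable of a generator u
    and i < c, then x_i u / x_c is a generator. Thus the ideal is the direct sum of
    the u K[x_c, ..., x_n], where u runs over the generators and x_c is the last
    variable of u. The central observation is that a module with such a
    decomposition, in which x_k u has linear coefficients for each variable with
    k < c, has a syzygy module with such a decomposition too, generated by the
    relations that express these products (syz_basis). Iteration gives a
    resolution whose matrices are linear (pommaret_linear_resolution).

    For (c) implies (d), let m be a monomial outside L such that x_i m is in L for
    s of the variables, where the other ones form a regular sequence on S/L and do
    not divide m. Going from S/L to the homology of the resolution modulo one of
    these variables after the other, m is lifted to a nonzero class in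
    Tor_(s-1)(L, K), of degree deg m + s. If L has an e-linear resolution, then
    deg m = e - 1 (socle_degree), where e is the least degree of an element of L
    (initial_degree). This is applied to monomials that are maximal among the
    missing ones. For the localization, in which x_n is regular, it shows that all
    monomials of degree d - k in the other variables are present; then for I, which
    therefore contains the monomials of degree at least d with exponent k of x_n, it
    shows that those with a smaller exponent are present as well
    (linear_veronese). *)

(** * Polynomials with prescribed monomials *)

Section Support.
Variables (n : nat) (K : fieldType).
Local Notation S := {mpoly K[n]}.
Implicit Types (p q r : S) (P Q : 'X_{1..n} -> Prop).

(** Membership in a monomial ideal, in a subring generated by variables or in a
    graded piece is a condition on the monomials that occur; this predicate
    treats all of them at once. *)
Definition supported P p := forall m, p@_m != 0 -> P m.

Lemma mcoeffXM (k m : 'X_{1..n}) p :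
  ('X_[k] * p)@_m = if (k <= m)%MM then p@_(m - k)%MM else 0.
Proof.
rewrite -commr_mpolyX; case: ifP => [le_km|/negP nle_km].
  by rewrite -{1}(submK le_km) addmC mcoeffMX.
apply/eqP; rewrite mcoeff_eq0 (perm_mem (msuppMX _ _)).
by apply/mapP => -[m' _ def_m]; apply: nle_km; rewrite def_m lem_addr.
Qed.

Lemma supported0 P : supported P 0.
Proof. by move=> m; rewrite mcoeff0 eqxx. Qed.

Lemma supportedD P p q : supported P p -> supported P q -> supported P (p + q).
Proof.
move=> Pp Pq m; rewrite mcoeffD; have [->|pm _] := eqVneq p@_m 0.
  by rewrite add0r; apply: Pq.
exact: Pp.
Qed.

Lemma supportedZ P (c : K) p : supported P p -> supported P (c *: p).
Proof. by move=> Pp m; rewrite mcoeffZ mulf_eq0 => /norP[_ /Pp]. Qed.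

Lemma supportedN P p : supported P p -> supported P (- p).
Proof. by rewrite -scaleN1r; apply: supportedZ. Qed.

Lemma supportedB P p q : supported P p -> supported P q -> supported P (p - q).
Proof. by move=> Pp Pq; apply: supportedD => //; apply: supportedN. Qed.

Lemma supported_sum (J : Type) (s : seq J) (A : pred J) P (F : J -> S) :
  (forall j, A j -> supported P (F j)) -> supported P (\sum_(j <- s | A j) F j).
Proof.
by move=> PF; apply: big_ind => //; [apply: supported0 | apply: supportedD].
Qed.

Lemma supportedX P m : P m -> supported P 'X_[m].
Proof.
by move=> Pm k; rewrite mcoeffX; case: (m =P k) => [<-|]; rewrite ?eqxx.
Qed.

Lemma supportedM P Q T p q :
    supported P p -> supported Q q ->
    (forall m1 m2, P m1 -> Q m2 -> T (m1 + m2)%MM) ->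
  supported T (p * q).
Proof.
move=> Pp Qq PQ; rewrite mpolyME; apply: supported_sum => -[m1 m2] /= _.
have [->|p1] := eqVneq p@_m1 0.
  by rewrite mul0r scale0r; apply: supported0.
have [->|q2] := eqVneq q@_m2 0.
  by rewrite mulr0 scale0r; apply: supported0.
by apply: supportedZ; apply: supportedX; apply: PQ; [apply: Pp | apply: Qq].
Qed.

Lemma sub_supported P Q p :
  (forall m, P m -> Q m) -> supported P p -> supported Q p.
Proof. by move=> PQ Pp m /Pp/PQ. Qed.

Lemma eq_supported P Q p :
  (forall m, P m <-> Q m) -> supported P p <-> supported Q p.
Proof. by move=> PQ; split; apply: sub_supported => m /PQ. Qed.

Lemma homogP d p : p \is d.-homog <-> supported (fun m => mdeg m = d) p.
Proof.
split=> [/dhomogP hom m pm|hom]; first by apply: hom; rewrite mcoeff_msupp.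
by apply/dhomogP => m; rewrite mcoeff_msupp; apply: hom.
Qed.

Definition restrict (A : pred 'X_{1..n}) p :=
  \sum_(m <- msupp p | A m) p@_m *: 'X_[m].

Lemma mcoeff_restrict (A : pred 'X_{1..n}) p m :
  (restrict A p)@_m = if A m then p@_m else 0.
Proof.
rewrite /restrict [in RHS](mpolyE p).
rewrite !raddf_sum /=; case: ifP => Am; last first.
  rewrite big1 // => k Ak; rewrite mcoeffZ mcoeffX.
  by case: (k =P m) Ak => [->|]; rewrite ?Am ?mulr0.
rewrite big_mkcond /=; apply: eq_bigr => k _; case: ifP => // nAk.
by rewrite mcoeffZ mcoeffX; case: (k =P m) nAk => [->|]; rewrite ?Am ?mulr0.
Qed.

Lemma restrict_compl (A : pred 'X_{1..n}) p :
  p = restrict A p + restrict (predC A) p.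
Proof.
apply/mpolyP => m; rewrite mcoeffD !mcoeff_restrict /=.
by case: (A m); rewrite ?addr0 ?add0r.
Qed.

Lemma mcoeff_neq0_mulX (i : 'I_n) p m :
  p@_m != 0 -> ('X_i * p)@_(m + U_(i)) != 0.
Proof.
rewrite mcoeffXM (_ : (U_(i) <= m + U_(i))%MM); last by rewrite addmC lem_addr.
by rewrite addmK.
Qed.

Lemma dvdX_supported (i : 'I_n) P p :
    supported (fun m => m i != 0%N /\ P m) p ->
  exists2 r, p = 'X_i * r & supported (fun m => P (m + U_(i))%MM) r.
Proof.
move=> Pp; exists (\sum_(m <- msupp p) p@_m *: 'X_[m - U_(i)]).
  rewrite mulr_sumr {1}[p]mpolyE [LHS]big_seq [RHS]big_seq; apply: eq_bigr => m.
  rewrite mcoeff_msupp => /Pp[mi _]; rewrite -scalerAr -mpolyXD addmC submK //.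
  by rewrite lep1mP.
rewrite big_seq; apply: supported_sum => m.
rewrite mcoeff_msupp => /Pp[mi Pm]; apply: supportedZ; apply: supportedX.
by rewrite submK // lep1mP.
Qed.

End Support.

(** The subring K[x_c, ..., x_(n-1)]. *)
Local Notation in_tail c :=
  (supported
     (fun m => forall i, (nat_of_ord i < c)%N -> fun_of_multinom m i = 0%N)).

(** * Syzygies of Pommaret bases *)

Section Pommaret.
Variables (n : nat) (K : fieldType).
Local Notation S := {mpoly K[n]}.

Definition linear_row k (L : 'M[K]_(k, n)) : 'rV[S]_k :=
  \row_b \sum_i L b i *: 'X_i.

(** The rows h_a of a matrix, with a class for each, such that the module that
    they generate is the direct sum of the K[x_c, ..., x_(n-1)] h_a, where c is
    the class of h_a: these variables are called multiplicative for h_a. Freeness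
    is pb_free. Generation is only required of the products of h_a by a single
    non-multiplicative variable, with linear coefficients (pb_cont); it follows
    for all products (row_reducible). *)
Record pommaret_basis := PommaretBasis {
  pb_size : nat;
  pb_width : nat;
  pb_mx : 'M[S]_(pb_size, pb_width);
  pb_class : 'I_pb_size -> nat;
  pb_cont : forall a (k : 'I_n), (k < pb_class a)%N ->
    exists L : 'M[K]_(pb_size, n),
      [forall b, forall i : 'I_n, (i < pb_class b)%N ==> (L b i == 0)]
      && ('X_k *: row a pb_mx == linear_row L *m pb_mx);
  pb_free : forall p : 'rV_pb_size,
    (forall a, in_tail (pb_class a) (p 0 a)) -> p *m pb_mx = 0 -> p = 0
}.

Section Syzygies.
Variable B : pommaret_basis.
Local Notation r := (pb_size B).
Local Notation cls := (@pb_class B).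
Local Notation H := (pb_mx B).

Definition nonmult := {ak : 'I_r * 'I_n | (ak.2 < cls ak.1)%N}.

Definition syz_size := #|{: nonmult}|.
Definition syz_src (t : 'I_syz_size) : 'I_r := (val (enum_val t)).1.
Definition syz_var (t : 'I_syz_size) : 'I_n := (val (enum_val t)).2.

Lemma syz_var_lt t : (syz_var t < cls (syz_src t))%N.
Proof. exact: valP (enum_val t). Qed.

Lemma syz_idx_ex a (k : 'I_n) :
  (k < cls a)%N -> exists t, syz_src t = a /\ syz_var t = k.
Proof.
move=> ka; exists (enum_rank (Sub (a, k) ka : nonmult)).
by rewrite /syz_src /syz_var enum_rankK SubK.
Qed.

Lemma syz_idx_inj t t' :
  syz_src t = syz_src t' -> syz_var t = syz_var t' -> t = t'.
Proof.
move=> eqs eqv; apply/enum_val_inj/val_inj.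
by rewrite [LHS]surjective_pairing [RHS]surjective_pairing; congr (_, _).
Qed.

(** The relations x_k e_a - L, one for each row a and each variable x_k that is
    not multiplicative for it, where L rewrites x_k h_a in the basis. They form
    a basis of the same kind of the module of syzygies, if the relation that comes
    from x_k is given the class k. *)
Definition syz_coef t := xchoose (pb_cont (syz_var_lt t)).

Lemma syz_coef0 t b (i : 'I_n) : (i < cls b)%N -> syz_coef t b i = 0.
Proof.
case/andP: (xchooseP (pb_cont (syz_var_lt t))) => /forallP/(_ b).
by move=> /forallP/(_ i)/implyP L0 _ /L0/eqP.
Qed.

Lemma syz_coefE t :
  'X_(syz_var t) *: row (syz_src t) H = linear_row (syz_coef t) *m H.
Proof. by case/andP: (xchooseP (pb_cont (syz_var_lt t))) => _ /eqP. Qed.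

Definition syz_row t : 'rV[S]_r :=
  'X_(syz_var t) *: delta_mx 0 (syz_src t) - linear_row (syz_coef t).
Definition syz_mx : 'M[S]_(syz_size, r) := \matrix_t syz_row t.

Lemma syz_mx_mul : syz_mx *m H = 0.
Proof.
apply/row_matrixP => t; rewrite row_mul rowK row0 mulmxBl -scalemxAl -rowE.
by rewrite syz_coefE subrr.
Qed.

Lemma syz_mxE t b :
  syz_mx t b =
  (syz_src t == b)%:R *: 'X_(syz_var t) - \sum_i syz_coef t b i *: 'X_i.
Proof.
rewrite !mxE eqxx /= [b == _]eq_sym; congr (_ - _).
by case: eqP; rewrite ?mulr1 ?mulr0 ?scale1r ?scale0r.
Qed.

(** The weight drops when a variable is replaced by a later one. Rewriting
    x_k e_a into L turns the first variable of a monomial into a later one,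
    unless all variables become multiplicative, so that the reduction
    terminates. *)
Definition wt (m : 'X_{1..n}) := (\sum_(i < n) m i * (n - i))%N.

Lemma wtD m1 m2 : wt (m1 + m2)%MM = (wt m1 + wt m2)%N.
Proof.
by rewrite /wt -big_split; apply: eq_bigr => i _; rewrite mnmDE mulnDl.
Qed.

Lemma wtU i : wt U_(i)%MM = (n - i)%N.
Proof.
rewrite /wt (bigD1 i) //= mnm1E eqxx mul1n big1 ?addn0 // => j.
by rewrite mnm1E eq_sym => /negbTE->.
Qed.

(** The predicate D keeps track of the degrees that occur in p, so that
    the reduction of a homogeneous row is homogeneous. *)
Definition reducible (D : pred nat) (p : 'rV[S]_r) :=
  exists (q : 'rV[S]_syz_size) (u : 'rV[S]_r),
  [/\ forall t, in_tail (syz_var t) (q 0 t),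
      forall t, supported (fun m => D (mdeg m).+1) (q 0 t),
      forall a, in_tail (cls a) (u 0 a)
    & p = q *m syz_mx + u].

Lemma reducible0 D : reducible D 0.
Proof.
exists 0, 0; split=> [t|t|a|]; last by rewrite mul0mx addr0.
all: by rewrite mxE; apply: supported0.
Qed.

Lemma reducibleD D p1 p2 :
  reducible D p1 -> reducible D p2 -> reducible D (p1 + p2).
Proof.
case=> [q1 [u1 [q1t q1d u1t ->]]] [q2 [u2 [q2t q2d u2t ->]]].
exists (q1 + q2), (u1 + u2); split=> [t|t|a|]; last by rewrite mulmxDl addrACA.
all: by rewrite mxE; apply: supportedD.
Qed.

Lemma reducibleZ D (c : K) p : reducible D p -> reducible D (c%:MP *: p).
Proof.
case=> [q [u [qt qd ut ->]]].
exists (c%:MP *: q), (c%:MP *: u); split=> [t|t|a|];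
  last by rewrite scalerDr scalemxAl.
all: by rewrite mxE mul_mpolyC; apply: supportedZ.
Qed.

Lemma reducible_sum D (J : Type) (s : seq J) (A : pred J) F :
  (forall j, A j -> reducible D (F j)) -> reducible D (\sum_(j <- s | A j) F j).
Proof.
by move=> RF; apply: big_ind => //; [apply: reducible0|apply: reducibleD].
Qed.

Lemma reducible_tail D (u : 'rV[S]_r) :
  (forall a, in_tail (cls a) (u 0 a)) -> reducible D u.
Proof.
move=> ut; exists 0, u; split=> // [t|t|]; last by rewrite mul0mx add0r.
all: by rewrite mxE; apply: supported0.
Qed.

Lemma monomial_row_tail (m : 'X_{1..n}) a b :
    (forall i : 'I_n, (i < cls a)%N -> m i = 0%N) ->
  in_tail (cls b) (('X_[m] *: delta_mx 0 a : 'rV[S]_r) 0 b).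
Proof.
move=> mt; rewrite !mxE eqxx /=; case: eqP => [->|_]; last first.
  by rewrite mulr0; apply: supported0.
by rewrite mulr1; apply: supportedX.
Qed.

Lemma linear_row_delta L :
  linear_row L =
  \sum_(b < r) \sum_i (L b i)%:MP *: ('X_i *: delta_mx 0 b) :> 'rV[S]_r.
Proof.
apply/rowP => b; rewrite !mxE summxE (bigD1 b) //= [X in _ = _ + X]big1 ?addr0.
  by rewrite summxE; apply: eq_bigr => i _; rewrite !mxE !eqxx mulr1 mul_mpolyC.
move=> b' nb; rewrite summxE big1 // => i _.
by rewrite !mxE eq_sym (negbTE nb) andbF !mulr0.
Qed.

Lemma monomial_reducible (D : pred nat) m a :
  D (mdeg m) -> reducible D ('X_[m] *: delta_mx 0 a).
Proof.
elim: {m}(wt m).+1 {-2}m a (ltnSn (wt m)) => // w IH m a; rewrite ltnS => wm Dm.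
have [mt|] := classic (forall i : 'I_n, (i < cls a)%N -> m i = 0%N).
  by apply: reducible_tail => b; apply: monomial_row_tail.
move=> /not_all_ex_not[i0 nt].
have ex0 : m i0 != 0%N by apply/eqP => E; apply: nt.
(* k is the first variable of m; it is not multiplicative for a *)
have [k mk mink] :=
  @arg_minnP _ i0 (fun i => m i != 0%N) (fun i : 'I_n => val i) ex0.
have ka : (k < cls a)%N.
  apply: leq_ltn_trans (mink _ ex0) _; rewrite ltnNge; apply/negP => le.
  by apply: nt => lt; move: lt; rewrite ltnNge le.
have [t [tsrc tvar]] := syz_idx_ex ka.
set mu := (m - U_(k))%MM.
have def_m : (mu + U_(k))%MM = m by rewrite submK // lep1mP.
have mu0 (i : 'I_n) : (i < k)%N -> mu i = 0%N.
  rewrite ltnNge => lt; apply/eqP/negPn/negP => mui.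
  by case/negP: lt; apply: mink; rewrite -def_m mnmDE; case: (mu i) mui.
have -> : 'X_[m] *: delta_mx 0 a
    = 'X_[mu] *: syz_row t + 'X_[mu] *: linear_row (syz_coef t) :> 'rV[S]_r.
  by rewrite -scalerDr subrK tsrc tvar scalerA -mpolyXD def_m.
apply: reducibleD.
  exists ('X_[mu] *: delta_mx 0 t), 0; split.
  - move=> t'; rewrite !mxE eqxx /=; case: eqP => [->|_].
      by rewrite mulr1 tvar; apply: supportedX.
    by rewrite mulr0; apply: supported0.
  - move=> t'; rewrite !mxE eqxx /=; case: eqP => [_|_].
      rewrite mulr1; apply: supportedX.
      by rewrite -addn1 -(mdeg1 k) -mdegD def_m.
    by rewrite mulr0; apply: supported0.
  - by move=> b; rewrite mxE; apply: supported0.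
  by rewrite addr0 -scalemxAl -rowE rowK.
rewrite linear_row_delta scaler_sumr; apply: reducible_sum => b _.
rewrite scaler_sumr; apply: reducible_sum => i _.
have [lt_ib|le_bi] := ltnP i (cls b).
  by rewrite syz_coef0 // mpolyC0 scale0r scaler0; apply: reducible0.
rewrite scalerA mulrC -scalerA; apply: reducibleZ.
rewrite scalerA -mpolyXD.
have [le_ik|lt_ki] := leqP i k.
  (* all variables of mu * x_i come after x_i, so they are multiplicative for b *)
  apply: reducible_tail => b'; apply: monomial_row_tail => j lt_jb.
  rewrite mnmDE mu0 ?mnm1E ?add0n; last by lia.
  by case: eqP => // eq_ij; move: lt_jb; rewrite -eq_ij ltnNge le_bi.
apply: IH; last by rewrite mdegD mdeg1 -(mdeg1 k) -mdegD def_m.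
apply: leq_trans wm; rewrite -def_m !wtD !wtU.
by have := ltn_ord i; lia.
Qed.

Lemma row_reducible (D : pred nat) (p : 'rV[S]_r) :
  (forall a, supported (fun m => D (mdeg m)) (p 0 a)) -> reducible D p.
Proof.
move=> pD; rewrite [p]row_sum_delta; apply: reducible_sum => a _.
rewrite [p 0 a]mpolyE scaler_suml big_seq; apply: reducible_sum => m.
rewrite mcoeff_msupp => /pD Dm; rewrite -mul_mpolyC -scalerA.
by apply: reducibleZ; apply: monomial_reducible.
Qed.

(** Modulo the relations, a row of coefficients becomes a row of multiplicative
    ones, which vanishes as soon as its image does. *)
Lemma syz_exact (v : 'rV[S]_r) : v *m H = 0 <-> exists w, v = w *m syz_mx.
Proof.
split=> [vH|[w ->]]; last by rewrite -mulmxA syz_mx_mul mulmx0.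
have [//|q [u [_ _ ut def_v]]] := @row_reducible predT v.
exists q; rewrite def_v (pb_free ut) ?addr0 //.
by move: vH; rewrite def_v mulmxDl -mulmxA syz_mx_mul mulmx0 add0r.
Qed.

(** The product of a relation by a variable is a syzygy with entries of degree
    2. Its reduction by the relations leaves a multiplicative syzygy, that is 0,
    and the coefficients in this reduction are linear. *)
Lemma syz_cont t (k : 'I_n) : (k < syz_var t)%N ->
  exists L : 'M[K]_(syz_size, n),
      [forall t', forall i : 'I_n, (i < syz_var t')%N ==> (L t' i == 0)]
      && ('X_k *: row t syz_mx == linear_row L *m syz_mx).
Proof.
move=> kt.
have [|q [u [qt qd ut def_p]]] :=
    @row_reducible (pred1 2) ('X_k *: row t syz_mx).
  have lin i : supported (fun m => mdeg m == 1%N) ('X_i : S).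
    by apply: supportedX; rewrite mdeg1.
  move=> a; rewrite mxE [row _ _ _ _]mxE syz_mxE.
  apply: (@supportedM _ _ (fun m => mdeg m == 1%N)
                          (fun m => mdeg m == 1%N)) => //.
    apply: supportedB; first exact: supportedZ.
    by apply: supported_sum => i _; apply: supportedZ.
  by move=> m1 m2 /eqP d1 /eqP d2; rewrite /= mdegD d1 d2.
have u0 : u = 0.
  apply: (pb_free ut); move/(congr1 (mulmx^~ H)): def_p.
  rewrite mulmxDl -!mulmxA -scalemxAl -row_mul syz_mx_mul row0 scaler0 mulmx0.
  by rewrite add0r.
pose L := \matrix_(t' < syz_size, i < n) (q 0 t')@_(U_(i)).
exists L; apply/andP; split.
  apply/forallP => t'; apply/forallP => i; apply/implyP => lt.
  rewrite mxE; apply: contraT => /qt/(_ _ lt).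
  by rewrite mnm1E eqxx.
rewrite def_p u0 addr0; apply/eqP; congr (_ *m _).
apply/rowP => t'; rewrite [RHS]mxE; apply/mpolyP => m.
rewrite raddf_sum /=.
have [/mdeg1P[i /eqP ->]|nm] := boolP (mdeg m == 1%N).
  rewrite (bigD1 i) //= !mcoeffZ mcoeffX eqxx mulr1 mxE big1 ?addr0 // => j ji.
  by rewrite mcoeffZ mcoeffX eq_mnm1 (negbTE ji) mulr0.
rewrite big1 => [|i _]; first by apply: contraNeq nm => /qd /=; rewrite eqSS.
rewrite mcoeffZ mcoeffX; have [eqm|_] := eqVneq U_(i)%MM m.
  by case/negP: nm; rewrite -eqm mdeg1.
by rewrite mulr0.
Qed.

(** The relation with index t, source a and variable x_k has the leading term
    x_k e_a. If x^m occurs in its coefficient q_t, then the only other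
    contributions to the coefficient of x^m x_k e_a come from monomials of larger
    weight. Hence q vanishes, by descending induction on the weight. *)
Lemma syz_free (q : 'rV[S]_syz_size) :
  (forall t, in_tail (syz_var t) (q 0 t)) -> q *m syz_mx = 0 -> q = 0.
Proof.
move=> qt qs0.
pose W t m := wt (m + U_(syz_var t))%MM.
have [b bound] : exists b, forall (t : 'I_syz_size) m,
    (q 0 t)@_m != 0 -> (W t m < b)%N.
  exists (\max_(t : 'I_syz_size) \max_(m <- msupp (q 0%R t)) (W t m)).+1.
  move=> t m qtm.
  have le1 : (W t m <= \max_(m <- msupp (q 0%R t)) W t m)%N.
    by apply: leq_bigmax_seq => //; rewrite mcoeff_msupp.
  by rewrite ltnS (leq_trans le1) // (leq_bigmax t).
suff q0 j t m : (b <= W t m + j)%N -> (q 0 t)@_m = 0.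
  apply/rowP => t; rewrite mxE; apply/mpolyP => m; rewrite mcoeff0.
  by apply: (q0 b); rewrite leq_addl.
elim: j t m => [|j IH] t m le_b.
  by apply/eqP; apply: contraTT le_b => /bound; rewrite addn0 -ltnNge.
apply/eqP; apply: contraT => qtm; have mt := qt _ _ qtm.
set k := syz_var t in mt *; set nu := (m + U_(k))%MM.
have nu_gt0 : nu k != 0%N by rewrite mnmDE mnm1E eqxx addn1.
have nu0 (i : 'I_n) : (i < k)%N -> nu i = 0%N.
  by move=> ik; rewrite mnmDE mt // mnm1E; case: eqP ik => // ->; rewrite ltnn.
have low t' m' : (q 0 t')@_m' != 0 -> m' k != 0%N -> (syz_var t' <= k)%N.
  by move=> qm' m'k; rewrite leqNgt; apply: contra m'k => /(qt _ _ qm') ->.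
have /(congr1 (mcoeff nu)) : (q *m syz_mx) 0 (syz_src t) = 0 by rewrite qs0 mxE.
rewrite mcoeff0 mxE raddf_sum (bigD1 t) //= syz_mxE eqxx scale1r.
(* the monomials of the tail of a generator only meet coefficients of q of
   larger weight *)
have other t' (i : 'I_n) : (cls (syz_src t) <= i)%N -> (q 0 t' * 'X_i)@_nu = 0.
  move=> le_ai; rewrite mulrC mcoeffXM; case: ifP => // le_nu.
  have lt_ki : (k < i)%N := leq_trans (syz_var_lt t) le_ai.
  apply/eqP; apply: contraT => q'; have le_k'k : (syz_var t' <= k)%N.
    apply: (low _ _ q'); rewrite mnmBE mnm1E.
    by rewrite -val_eqE /= (gtn_eqF lt_ki) subn0.
  case/negP: (q'); apply/eqP; apply: IH.
  move: le_b; rewrite /W -/k -/nu wtD -{1}(submK le_nu) wtD !wtU.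
  by have := ltn_ord i; lia.
have lin t' : (q 0 t' * \sum_i syz_coef t' (syz_src t) i *: 'X_i)@_nu = 0.
  rewrite mulr_sumr raddf_sum big1 //= => i _.
  rewrite -scalerAr mcoeffZ; have [lt|le] := ltnP i (cls (syz_src t)).
    by rewrite syz_coef0 // mul0r.
  by rewrite other // mulr0.
rewrite mulrBr mcoeffB lin subr0 big1 ?addr0 => [|t' nt].
  by rewrite mulrC mcoeffXM lem_addl addmK => /eqP; rewrite (negbTE qtm).
(* another generator whose leading monomial divides nu in the same coordinate
   would have a different variable, but both variables are the first one of nu *)
rewrite syz_mxE mulrBr mcoeffB lin subr0.
case: eqP => [eqs|_]; last by rewrite scale0r mulr0 mcoeff0.
rewrite scale1r mulrC mcoeffXM; case: ifP => // le_nu.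
have k'k : syz_var t' != k.
  by apply: contraNneq nt => eqv; apply/eqP/syz_idx_inj.
apply/eqP; apply: contraT => q'.
have nuk' : nu (syz_var t') != 0%N by rewrite -lep1mP.
have [lt|lt|/val_inj eqv] := ltngtP (syz_var t') k; last by rewrite eqv eqxx in k'k.
  by rewrite nu0 in nuk'.
have := low _ _ q'; rewrite leqNgt lt; apply.
by rewrite mnmBE mnm1E (negbTE k'k) subn0.
Qed.

Definition syz_basis : pommaret_basis :=
  @PommaretBasis _ _ syz_mx _ syz_cont syz_free.

End Syzygies.
End Pommaret.

Section LinearResolution.
Variables (n : nat) (K : fieldType).
Local Notation S := {mpoly K[n]}.

Lemma syz_mx_homog (B : pommaret_basis n K) t b : syz_mx B t b \is 1.-homog.
Proof.
have lin (i : 'I_n) : ('X_i : S) \is 1.-homog by rewrite dhomogX /= mdeg1.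
rewrite syz_mxE rpredB ?rpredZ //.
by apply: rpred_sum => i _; rewrite rpredZ.
Qed.

(** Taking syzygies over and over yields a resolution all of whose maps have
    linear entries. Then F_i is generated in degree i + e alone, so that Tor_i
    has nothing in the other degrees. *)
Lemma pommaret_linear_resolution e r (H : 'cV[S]_r) cls
    (cont : forall a (k : 'I_n), (k < cls a)%N ->
      exists L : 'M[K]_(r, n),
      [forall b, forall i : 'I_n, (i < cls b)%N ==> (L b i == 0)]
      && ('X_k *: row a H == linear_row L *m H))
    (free : forall p : 'rV_r,
      (forall a, in_tail (cls a) (p 0 a)) -> p *m H = 0 -> p = 0)
    (L : S -> Prop) :
    (forall a, H a 0 \is e.-homog) ->
    (forall p, L p <-> exists v : 'rV_r, p = (v *m H) 0 0) ->
  linear_resolution L.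
Proof.
move=> Hhom Lim.
pose B0 := PommaretBasis cont free.
pose stage i := iter i (@syz_basis n K) B0.
unshelve eexists.
  apply: (@GradedFreeResolution n K L (fun i => pb_size (stage i))
    (fun i _ => (i + e)%N) (fun i => syz_mx (stage i)) H) => //.
  - by move=> i a b _; exists 1%N; [lia | apply: syz_mx_homog].
  - exact: (@syz_exact _ _ B0).
  by move=> i v; apply: (@syz_exact _ _ (stage i.+1)).
exists e => i j ne v vj _; exists 0; first by move=> a _; rewrite mxE.
rewrite mul0mx; apply/rowP => a; rewrite mxE vj //=.
by rewrite eq_sym.
Qed.

End LinearResolution.

(** * Ideals of Veronese type *)

Section Monomials.
Variable n : nat.
Implicit Types m u v : 'X_{1..n}.

Lemma lem_mdeg u m : (u <= m)%MM -> (mdeg u <= mdeg m)%N.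
Proof. by move=> /submK <-; rewrite mdegD leq_addl. Qed.

Lemma lem_mdeg_eq u m : (u <= m)%MM -> mdeg u = mdeg m -> u = m.
Proof.
move=> le_um eq_d; rewrite -(submK le_um).
move: (congr1 mdeg (submK le_um)); rewrite mdegD eq_d => /eqP.
by rewrite -{2}[mdeg m]add0n eqn_add2r mdeg_eq0 => /eqP->; rewrite add0m.
Qed.

Lemma mdeg_ltn_index u v : (mdeg u < mdeg v)%N -> exists i, (u i < v i)%N.
Proof.
move=> lt_uv; apply/existsP; apply: contraLR lt_uv => /existsPn le.
by rewrite -leqNgt; apply: lem_mdeg; apply/mnm_lepP => i; rewrite leqNgt.
Qed.

Lemma mdeg_divisor d m : (d <= mdeg m)%N -> exists2 u, (u <= m)%MM & mdeg u = d.
Proof.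
elim: {m}(mdeg m) {-2}m (erefl (mdeg m)) => [|e IH] m def_e le_d.
  by exists m; [apply: lepm_refl | lia].
have [eq_d|ne_d] := eqVneq d (mdeg m); first by exists m; [apply: lepm_refl|].
have [|i] := @mdeg_ltn_index 0%MM m; first by rewrite mdeg0 def_e.
rewrite mnm0E => mi; have le_im : (U_(i) <= m)%MM by rewrite lep1mP -lt0n.
have := congr1 mdeg (submK le_im); rewrite mdegD mdeg1 => eqd.
have [||u le_u du] := IH (m - U_(i))%MM; [by lia | by lia |].
by exists u => //; apply: lepm_trans le_u (lem_subr _ _).
Qed.

(** For the unit monomial this is 0, which makes all variables
    multiplicative for it. *)
Definition top_index m : nat := \max_(i < n | m i != 0%N) i.

Lemma gt_top_index m (i : 'I_n) : (top_index m < i)%N -> m i = 0%N.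
Proof.
move=> lt_i; apply/eqP; apply: contraLR lt_i => mi.
rewrite -leqNgt.
exact: (@leq_bigmax_cond _ (fun i => m i != 0%N) (fun i : 'I_n => val i) i).
Qed.

Lemma top_index_attained m :
  (0 < top_index m)%N -> exists2 c : 'I_n, val c = top_index m & m c != 0%N.
Proof.
rewrite /top_index; elim/big_ind: _ => // [x y Px Py|i mi _]; last by exists i.
by rewrite /maxn; case: ifP.
Qed.

Lemma top_index_min m c :
  (forall i : 'I_n, (c < i)%N -> m i = 0%N) -> (top_index m <= c)%N.
Proof.
move=> mc; apply/bigmax_leqP => i; apply: contraNT; rewrite -ltnNge => /mc ->.
by [].
Qed.

(** If the variables of u1 m1 are written in increasing order, then u1 is the
    word of the first d letters. *)
Lemma prefix_factor_unique d u1 m1 u2 m2 :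
    mdeg u1 = d -> mdeg u2 = d ->
    (forall i : 'I_n, (i < top_index u1)%N -> m1 i = 0%N) ->
    (forall i : 'I_n, (i < top_index u2)%N -> m2 i = 0%N) ->
  (m1 + u1 = m2 + u2)%MM -> u1 = u2.
Proof.
wlog le12: u1 m1 u2 m2 / (top_index u1 <= top_index u2)%N => [H|].
  move=> d1 d2 t1 t2 E.
  case/orP: (leq_total (top_index u1) (top_index u2)) => le.
    exact: (H u1 m1 u2 m2).
  by apply/esym; apply: (H u2 m2 u1 m1).
move=> d1 d2 t1 t2 E.
have Ei i : (m1 i + u1 i = m2 i + u2 i)%N by rewrite -!mnmDE E.
suff [le|le] : (u1 <= u2)%MM \/ (u2 <= u1)%MM.
- by apply: lem_mdeg_eq; rewrite ?d1 ?d2.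
- by apply/esym/lem_mdeg_eq; rewrite ?d1 ?d2.
have out1 (i : 'I_n) : val i != top_index u1 -> (u1 i <= u2 i)%N.
  rewrite neq_ltn => /orP[lt|/gt_top_index -> //].
  by have := Ei i; rewrite t1 // t2 ?(leq_trans lt) //; lia.
have [[i /eqP ii lt]|none] :=
    classic (exists2 i : 'I_n, val i = top_index u1 & (u2 i < u1 i)%N).
  right; apply/mnm_lepP => j; have [->|ne] := eqVneq j i; first exact: ltnW.
  move: le12; rewrite leq_eqVlt => /orP[/eqP eqt|lt12].
    move: ne; rewrite -val_eqE /= (eqP ii) neq_ltn => /orP[ltj|gtj].
      by have := Ei j; rewrite t1 // t2 -?eqt //; lia.
    by rewrite [u2 j]gt_top_index // -eqt.
  by have := Ei i; rewrite t2 ?(eqP ii) //; lia.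
left; apply/mnm_lepP => j.
have [eqj|] := eqVneq (val j) (top_index u1); last exact: out1.
by rewrite leqNgt; apply/negP => lt; apply: none; exists j.
Qed.

End Monomials.

Section Veronese.
Variables (n : nat) (K : fieldType) (d k : nat).
Local Notation S := {mpoly K[n.+1]}.

Definition veronese_monomial (m : 'X_{1..n.+1}) :=
  exists u, [/\ mdeg u = d, (u ord_max <= k)%N & (u <= m)%MM].

Definition ver_gen :=
  {u : 'X_{1..n.+1 < d.+1} | (mdeg u == d) && (u ord_max <= k)%N}.
Local Notation r := #|{: ver_gen}|.
Definition ver_mon (a : 'I_r) : 'X_{1..n.+1} := val (val (enum_val a)).

Lemma ver_monP u :
  (exists a, ver_mon a = u) <-> (mdeg u = d /\ (u ord_max <= k)%N).
Proof.
split=> [[a <-]|[du uk]].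
  by case/andP: (valP (enum_val a)) => /eqP.
have ud : (mdeg u < d.+1)%N by rewrite du.
have ug : (mdeg (BMultinom ud) == d) && (BMultinom ud ord_max <= k)%N.
  by rewrite /= du eqxx.
exists (enum_rank (Sub (BMultinom ud) ug : ver_gen)).
by rewrite /ver_mon enum_rankK SubK.
Qed.

Lemma ver_mon_gen a : mdeg (ver_mon a) = d /\ (ver_mon a ord_max <= k)%N.
Proof. by apply/ver_monP; exists a. Qed.

Lemma ver_mon_inj : injective ver_mon.
Proof. by move=> a b /val_inj/val_inj/enum_val_inj. Qed.

Definition ver_col : 'cV[S]_r := \col_a 'X_[ver_mon a].

Lemma linear_row_delta_mx b (c : 'I_n.+1) :
  linear_row (delta_mx b c) = 'X_c *: delta_mx 0 b :> 'rV[S]_r.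
Proof.
apply/rowP => b'; rewrite !mxE eqxx /= (bigD1 c) //=.
rewrite big1 ?addr0 => [|i /negbTE ic].
  by rewrite mxE eqxx andbT; case: eqP; rewrite ?scale1r ?scale0r ?mulr1 ?mulr0.
by rewrite mxE ic andbF scale0r.
Qed.

(** A variable x_i that comes before the last variable x_c of u replaces it:
    x_i u = x_c (x_i u / x_c). The exponent of the last variable of the ring does
    not grow, so that x_i u / x_c is again a generator, and x_c does not come
    before its last variable. *)
Lemma ver_cont a (i : 'I_n.+1) : (i < top_index (ver_mon a))%N ->
  exists L : 'M[K]_(r, n.+1),
    [forall b, forall j : 'I_n.+1, (j < top_index (ver_mon b))%N ==> (L b j == 0)]
    && ('X_i *: row a ver_col == linear_row L *m ver_col).
Proof.
move=> lt_i; set u := ver_mon a.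
have [|c cu uc] := @top_index_attained _ u; first exact: leq_ltn_trans lt_i.
have [du uk] : mdeg u = d /\ (u ord_max <= k)%N := ver_mon_gen a.
have lt_ic : (i < c)%N by rewrite cu.
have le_cu : (U_(c) <= u)%MM by rewrite lep1mP.
have [b def_b] : exists b, ver_mon b = (u - U_(c) + U_(i))%MM.
  apply/ver_monP; split.
    have := congr1 mdeg (submK le_cu); rewrite !mdegD !mdeg1 => ->; exact: du.
  rewrite mnmDE mnmBE !mnm1E [i == _]negbTE; first by lia.
  by rewrite -val_eqE /= neq_ltn (leq_trans lt_ic) // -ltnS.
exists (delta_mx b c); apply/andP; split.
  apply/forallP => b'; apply/forallP => j; apply/implyP => lt_j.
  rewrite mxE; have [eb|_] //= := b' =P b; have [ej|_] //= := j =P c.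
  move: lt_j; rewrite eb ej def_b ltnNge => /negP[]; apply: top_index_min => l lt_l.
  have ne_l: (i == l) = false by rewrite -val_eqE /= ltn_eqF // (ltn_trans lt_ic).
  by rewrite mnmDE mnmBE !mnm1E ne_l gt_top_index // -cu.
apply/eqP; rewrite linear_row_delta_mx -scalemxAl -rowE.
apply/rowP => z; rewrite !mxE def_b -!mpolyXD.
congr 'X_[_]; apply/mnmP => j; have /mnm_lepP/(_ j) := le_cu.
by rewrite !(mnmDE, mnmBE, mnm1E) -/u; lia.
Qed.

Lemma ver_free (p : 'rV[S]_r) :
    (forall a, in_tail (top_index (ver_mon a)) (p 0 a)) ->
  p *m ver_col = 0 -> p = 0.
Proof.
move=> pt p0; apply/rowP => a; rewrite mxE; apply/mpolyP => m; rewrite mcoeff0.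
apply/eqP; apply: contraT => pam; have mt := pt _ _ pam.
have /(congr1 (mcoeff (m + ver_mon a))) : (p *m ver_col) 0 0 = 0 by rewrite p0 mxE.
rewrite mcoeff0 mxE raddf_sum (bigD1 a) //= big1 ?addr0 => [|b ba].
  by rewrite mxE addmC mcoeffMX => /eqP; rewrite (negbTE pam).
rewrite mxE mulrC mcoeffXM; case: ifP => // le_b.
apply/eqP; apply: contraT => /pt bt; case/eqP: ba; apply: ver_mon_inj.
apply: (prefix_factor_unique (ver_mon_gen b).1 (ver_mon_gen a).1 bt mt).
by rewrite submK.
Qed.

Lemma ver_image (p : S) :
  supported veronese_monomial p <-> exists v : 'rV_r, p = (v *m ver_col) 0 0.
Proof.
split=> [pv|[v ->]]; last first.
  rewrite mxE; apply: supported_sum => a _.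
  apply: (@supportedM _ _ (fun=> True) (fun m => m = ver_mon a)) => //.
    by rewrite mxE; apply: supportedX.
  move=> m1 _ _ ->; exists (ver_mon a).
  by have [da ka] := ver_mon_gen a; split=> //; apply: lem_addl.
rewrite [p]mpolyE big_seq.
apply: (big_ind (fun q => exists v : 'rV[S]_r, q = (v *m ver_col) 0 0)).
- by exists 0; rewrite mul0mx mxE.
- by move=> p1 p2 [v1 ->] [v2 ->]; exists (v1 + v2); rewrite mulmxDl [RHS]mxE.
move=> m; rewrite mcoeff_msupp => /pv[u [du uk le_um]].
have [a def_a] : exists a, ver_mon a = u by apply/ver_monP.
exists ((p@_m *: 'X_[m - u]) *: delta_mx 0 a).
by rewrite -scalemxAl -rowE 3!mxE def_a -scalerAl -mpolyXD submK //.
Qed.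

(** This includes the powers of the ideal of all variables but the last
    (k = 0), the unit ideal (d = 0) and, in one variable, the zero ideal (k < d). *)
Lemma veronese_linear_resolution (L : S -> Prop) :
  (forall p, L p <-> supported veronese_monomial p) -> linear_resolution L.
Proof.
move=> Lp; apply: (pommaret_linear_resolution (e := d) ver_cont ver_free).
  move=> a; rewrite mxE dhomogX /=.
  by rewrite (ver_mon_gen a).1.
by move=> p; rewrite Lp ver_image.
Qed.

End Veronese.

(** * Resolutions modulo variables *)

Section ModVars.
Variables (n : nat) (K : fieldType).
Local Notation S := {mpoly K[n]}.
Implicit Types (V : seq 'I_n) (m : 'X_{1..n}).

Definition meets V m := has (fun i => m i != 0%N) V.

(** The rows with entries in the ideal of the variables in V, which form the
    kernel of the reduction modulo these variables. *)
Definition mod0 V r (v : 'rV[S]_r) := forall a, supported (meets V) (v 0 a).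

Lemma mod0D V r (v w : 'rV_r) : mod0 V v -> mod0 V w -> mod0 V (v + w).
Proof. by move=> v0 w0 a; rewrite mxE; apply: supportedD. Qed.

Lemma mod0N V r (v : 'rV_r) : mod0 V v -> mod0 V (- v).
Proof. by move=> v0 a; rewrite mxE; apply: supportedN. Qed.

Lemma mod0B V r (v w : 'rV_r) : mod0 V v -> mod0 V w -> mod0 V (v - w).
Proof. by move=> v0 w0; apply: mod0D => //; apply: mod0N. Qed.

Lemma meetsDl V m1 m2 : meets V m1 -> meets V (m1 + m2)%MM.
Proof.
case/hasP=> i iV mi; apply/hasP; exists i => //.
by rewrite mnmDE addn_eq0 negb_and mi.
Qed.

Lemma meetsDr V m1 m2 : meets V m2 -> meets V (m1 + m2)%MM.
Proof. by rewrite addmC; apply: meetsDl. Qed.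

Lemma mod0M V r s (v : 'rV_r) (A : 'M_(r, s)) : mod0 V v -> mod0 V (v *m A).
Proof.
move=> v0 b; rewrite mxE; apply: supported_sum => a _.
by apply: (supportedM (Q := fun=> True) (v0 a)) => // m1 m2 /meetsDl.
Qed.

Lemma mod0Z V r (c : S) (v : 'rV_r) : mod0 V v -> mod0 V (c *: v).
Proof.
move=> v0 a; rewrite mxE.
by apply: (supportedM (P := fun=> True) _ (v0 a)) => // m1 m2 _; apply: meetsDr.
Qed.

Lemma mod0_cons x V r (v : 'rV_r) : mod0 V v -> mod0 (x :: V) v.
Proof.
by move=> v0 a; apply: sub_supported (v0 a) => m mV; apply/orP; right.
Qed.

Lemma mod0_X x V r (v : 'rV_r) : mod0 (x :: V) ('X_x *: v).
Proof.
move=> a; rewrite mxE.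
apply: (supportedM (P := fun m => m = U_(x)%MM) (Q := fun=> True)) => //.
  exact: supportedX.
by move=> m1 m2 -> _; apply: meetsDl; rewrite /meets /= mnm1E eqxx.
Qed.

(** The variables form a regular sequence. *)
Lemma mod0_regular x V r (v : 'rV_r) :
  x \notin V -> mod0 V ('X_x *: v) -> mod0 V v.
Proof.
move=> xV v0 a m vm; have := v0 a (m + U_(x))%MM.
rewrite mxE => /(_ (mcoeff_neq0_mulX x vm))/hasP[i iV].
rewrite mnmDE mnm1E; have [eqx|_] := eqVneq x i; first by rewrite eqx iV in xV.
by rewrite addn0 => mi; apply/hasP; exists i.
Qed.

Lemma mod0_split x V r (v : 'rV_r) :
  mod0 (x :: V) v -> exists q w, mod0 V q /\ v = q + 'X_x *: w.
Proof.
move=> v0.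
have ex a : exists w, restrict (predC (meets V)) (v 0 a) = 'X_x * w.
  have [|w -> _] := @dvdX_supported n K x (fun=> True)
                      (restrict (predC (meets V)) (v 0 a)).
    move=> m; rewrite mcoeff_restrict.
    by case: ifP => [/negP nV /v0/orP[]|]; rewrite ?eqxx.
  by exists w.
have [w def_w] := fin_all_exists ex.
exists (\row_a restrict (meets V) (v 0 a)), (\row_a w a); split.
  by move=> a m; rewrite mxE mcoeff_restrict; case: ifP => //; rewrite eqxx.
by apply/rowP => a; rewrite !mxE -def_w -restrict_compl.
Qed.

End ModVars.

Section Augmented.
Variables (n : nat) (K : fieldType) (L : {mpoly K[n]} -> Prop).
Local Notation S := {mpoly K[n]}.
Variable F : graded_free_resolution L.
Implicit Types V : seq 'I_n.

(** The complex ... -> F_1 -> F_0 -> S -> 0, whose only homology is S/L, at S.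
    The zero module in place 0 puts S in place 1, so that S and the F_i are
    treated alike. *)
Definition aug_rank i : nat :=
  match i with 0 => 0 | 1 => 1 | i.+2 => gfr_rank F i end.

Definition aug_diff i : 'M[S]_(aug_rank i.+1, aug_rank i) :=
  match i with 0 => 0 | 1 => gfr_aug F | i.+2 => gfr_diff F i end.

Definition aug_deg i : 'I_(aug_rank i) -> nat :=
  match i with 0 => fun=> 0 | 1 => fun=> 0 | i.+2 => @gfr_deg _ _ _ F i end.

Local Notation rk := aug_rank.
Local Notation D := aug_diff.

Lemma aug_exact i (v : 'rV_(rk i.+2)) :
  v *m D i.+1 = 0 <-> exists w, v = w *m D i.+2.
Proof. by case: i v => [|i] v; [apply: gfr_exact0 | apply: gfr_exactS]. Qed.

Lemma aug_comp i (v : 'rV_(rk i.+2)) : v *m D i.+1 *m D i = 0.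
Proof.
case: i v => [|i] v; first by apply/matrixP => ? [].
by apply/aug_exact; exists v.
Qed.

Definition hom_row i (j : nat) (v : 'rV[S]_(rk i)) :=
  forall a, supported (fun m => mdeg m + aug_deg a == j)%N (v 0 a).

Lemma aug_diff_homog i a b :
  supported (fun m => mdeg m + aug_deg b == aug_deg a)%N (D i a b).
Proof.
case: i a b => [|[|i]] a b; first by case: b.
  move=> m /= ; rewrite ord1 addn0 => Dm.
  by move/homogP: (@gfr_aug_homog _ _ _ F a) => /(_ _ Dm) ->.
move=> m Dm /=; have [|c -> /homogP/(_ m Dm) ->] := @gfr_diff_homog _ _ _ F i a b.
  by apply: contraNneq Dm => /= ->; rewrite mcoeff0.
by rewrite addnC.
Qed.

Lemma hom_rowX i j k (v : 'rV[S]_(rk i)) :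
  hom_row j v -> hom_row j.+1 ('X_k *: v).
Proof.
move=> vj a; rewrite mxE.
apply: (supportedM (P := fun m => m = U_(k)%MM)
                   (Q := fun m => mdeg m + aug_deg a == j)%N) => //.
  exact: supportedX.
by move=> m1 m2 -> /eqP <-; rewrite mdegD mdeg1 addSn.
Qed.

Definition im_mod V i (z : 'rV[S]_(rk i)) :=
  exists w q, mod0 V q /\ z = w *m D i + q.

Lemma im_mod_homog V i (j : nat) (z : 'rV[S]_(rk i)) : hom_row j z -> im_mod V z ->
  exists w q, [/\ hom_row j w, mod0 V q & z = w *m D i + q].
Proof.
move=> zj [w [q [q0 def_z]]].
pose A (a : 'I_(rk i.+1)) (m : 'X_{1..n}) := (mdeg m + aug_deg a == j)%N.
pose w1 : 'rV[S]_(rk i.+1) := \row_a restrict (A a) (w 0 a).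
pose w2 : 'rV[S]_(rk i.+1) := \row_a restrict (predC (A a)) (w 0 a).
have def_w : w = w1 + w2.
  by apply/rowP => a; rewrite !mxE -restrict_compl.
have w1j : hom_row j w1.
  by move=> a m; rewrite mxE mcoeff_restrict; case: ifP; rewrite ?eqxx.
have w2j b : supported (fun m => mdeg m + aug_deg b != j)%N ((w2 *m D i) 0 b).
  rewrite mxE; apply: supported_sum => a _; rewrite mxE.
  have w2a : supported (fun m => ~~ A a m) (restrict (predC (A a)) (w 0 a)).
    by move=> m; rewrite mcoeff_restrict /=; case: (A a m); rewrite ?eqxx.
  apply: (supportedM w2a (aug_diff_homog (b := b))) => m1 m2.
  by rewrite /A => nj /eqP da; move: nj; rewrite -da mdegD addnA.
exists w1, (z - w1 *m D i); split=> //; last by rewrite addrC subrK.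
have hom_w1 : hom_row j (w1 *m D i).
  move=> b; rewrite mxE; apply: supported_sum => a _.
  apply: (supportedM (w1j a) (aug_diff_homog (b := b))) => m1 m2 /eqP <- /eqP <-.
  by rewrite mdegD addnA.
have def_e : z - w1 *m D i = w2 *m D i + q.
  by rewrite def_z def_w mulmxDl addrC -addrA addKr.
move=> b m nz; have /eqP mj : (mdeg m + aug_deg b == j)%N.
  by apply: (supportedB (zj b) (hom_w1 b)); rewrite !mxE in nz *.
apply: (q0 b); move: nz; rewrite def_e mxE mcoeffD.
have [->|/w2j] := eqVneq ((w2 *m D i) 0 b)@_m 0; first by rewrite add0r.
by rewrite mj eqxx.
Qed.

(** Exactness, beyond place t + 1, of the complex modulo the variables in V. *)
Definition exact_mod V t :=
  forall i (z : 'rV[S]_(rk i.+1)), (t < i)%N -> mod0 V (z *m D i) -> im_mod V z.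

Lemma exact_mod_nil : exact_mod [::] 0.
Proof.
case=> // i z _ zD0; have /aug_exact[w ->] : z *m D i.+1 = 0.
  apply/rowP => b; rewrite [RHS]mxE; apply/mpolyP => m; rewrite mcoeff0.
  by apply/eqP; apply: contraT => /(zD0 b).
by exists w, 0; split; [move=> a; rewrite mxE; apply: supported0 | rewrite addr0].
Qed.

(** By the long exact sequence of the multiplication by x, the reduction modulo a
    further variable moves homology up by at most one place. *)
Lemma exact_mod_cons x V t :
  x \notin V -> exact_mod V t -> exact_mod (x :: V) t.+1.
Proof.
move=> xV ex [|i] z //; rewrite ltnS => lt_ti /mod0_split[q [r [q0 def_zD]]].
have [|w [q' [q'0 def_r]]] := ex i r lt_ti.
  apply: (mod0_regular xV).
  have -> : 'X_x *: (r *m D i) = - (q *m D i).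
    apply/eqP; rewrite -addr_eq0 scalemxAl -mulmxDl addrC -def_zD.
    by rewrite aug_comp.
  exact/mod0N/mod0M.
have [||w' [q'' [q''0 def_z]]] := ex i.+1 (z - 'X_x *: w); first exact: ltnW.
  rewrite mulmxBl def_zD def_r scalerDr -scalemxAl.
  rewrite [_ + 'X_x *: q']addrC addrA addrK.
  by apply: mod0D => //; apply: mod0Z.
exists w', (q'' + 'X_x *: w); split.
  by apply: mod0D; [apply: mod0_cons | apply: mod0_X].
by rewrite addrA -def_z subrK.
Qed.

(** If x is regular on S/L, the first reduction creates no homology at all. *)
Lemma exact_mod_cons0 x :
  (forall p, L ('X_x * p) -> L p) -> exact_mod [:: x] 0.
Proof.
move=> regx [|[|i]] z // _ zD; last first.
  exact: (exact_mod_cons (x := x) (V := [::]) isT exact_mod_nil).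
have [q [r [q0 def_zD]]] := mod0_split zD.
have {q0}q0 : q = 0.
  apply/rowP => b; rewrite mxE; apply/mpolyP => m; rewrite mcoeff0.
  by apply/eqP; apply: contraT => /(q0 b).
rewrite {}q0 add0r in def_zD.
have /(@gfr_aug_image _ _ _ F)[w def_r] : L (r 0 0).
  apply: regx; apply/(@gfr_aug_image _ _ _ F); exists z.
  by rewrite -[z *m _]/(z *m D 1) def_zD mxE.
have {}def_r : r = w *m D 1 by apply/rowP => b; rewrite ord1.
have [w' def_z] : exists w', z - 'X_x *: w = w' *m D 2.
  by apply/(aug_exact (i := 0)); rewrite mulmxBl def_zD def_r scalemxAl subrr.
exists w', ('X_x *: w); split; first exact: mod0_X.
by rewrite -def_z subrK.
Qed.

(** As V contains all variables, this is for T > 1 the vanishing of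
    Tor_(T-1)(L, K) in degree J, expressed without passing to the quotient by V. *)
Definition tor_vanishes T J := forall V, (forall i, i \in V) ->
  forall z : 'rV[S]_(rk T.+1), hom_row J z -> mod0 V (z *m D T) -> im_mod V z.

(** Modulo all variables only the constant terms matter, and these form a row in
    the complex that computes Tor. *)
Lemma Tor_eq0_lift V i J (z : 'rV[S]_(rk i.+2)) :
    (forall k, k \in V) -> Tor_eq0 F i J -> hom_row J z ->
    ((0 < i)%N -> mod0 V (z *m D i.+1)) ->
  im_mod V z.
Proof.
move=> Vall Tor0 zJ zD.
pose v : 'rV[K]_(gfr_rank F i) := map_mx (mcoeff 0%MM) z.
have [||w _ def_v] := Tor0 v.
- move=> a ne; rewrite mxE; apply/eqP; apply: contraT => /(zJ a).
  by rewrite mdeg0 add0n /= (negbTE ne).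
- case: i Tor0 z zJ zD @v => [|i] Tor0 z zJ zD v; first by rewrite mulmx0.
  rewrite /tensor_diff_out /tensor_diff -map_mxM; apply/rowP => b; rewrite !mxE.
  apply/eqP; apply: contraT => nz; have := zD isT b 0%MM; rewrite mxE => /(_ nz).
  by case/hasP => k _; rewrite mnm0E.
pose w' : 'rV[S]_(rk i.+3) := map_mx (@mpolyC n K) w.
have const0 : map_mx (mcoeff 0%MM) (z - w' *m D i.+2) = 0.
  rewrite map_mxB map_mxM [map_mx _ w'](_ : _ = w); last first.
    by apply/rowP => a; rewrite !mxE; exact: mpolyCK.
  by rewrite -/v def_v subrr.
exists w', (z - w' *m D i.+2); split; last by rewrite addrC subrK.
move=> a m nz; have [m0|] := eqVneq m 0%MM; last first.
  rewrite -mdeg_eq0 -lt0n => m_gt0.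
  have [|k] := @mdeg_ltn_index n 0%MM m; first by rewrite mdeg0.
  by rewrite mnm0E lt0n => mk; apply/hasP; exists k.
by move/rowP/(_ a)/eqP: const0; rewrite mxE [X in _ == X]mxE -m0 (negbTE nz).
Qed.

Lemma Tor_eq0_vanishes i J : Tor_eq0 F i J -> tor_vanishes i.+1 J.
Proof. by move=> Tor0 V Vall z zJ zD; apply: Tor_eq0_lift Vall Tor0 zJ _. Qed.

(** Let a class modulo V be annihilated by the variables in l. The connecting map
    of the multiplication by x in l lifts it to a class modulo x and V, in the next
    place and of degree one more, that the other variables in l annihilate. Once
    l is exhausted, the class lives in Tor, where it vanishes; and a lift is only
    zero if the class is. *)
Lemma annihilated_class_eq0 l V t j T J (z : 'rV[S]_(rk t.+1)) :
    uniq (l ++ V) -> (forall i, i \in l ++ V) ->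
    T = (t + size l)%N -> J = (j + size l)%N -> tor_vanishes T J ->
    exact_mod V t -> hom_row j z -> mod0 V (z *m D t) ->
    (forall k, k \in l -> im_mod V ('X_k *: z)) ->
  im_mod V z.
Proof.
elim: l V t j z => [|x l IH] V t j z Ul lV.
  rewrite !addn0 => -> -> van _ zj zD _; exact: van.
rewrite /= !addnS -!addSn => def_T def_J van ex zj zD soc.
have [xV Ul'] : x \notin V /\ uniq (l ++ x :: V).
  split; last by rewrite (perm_uniq (permEl (perm_catCA l [:: x] V))).
  by move: Ul => /= /andP[]; rewrite mem_cat => /norP[].
have [w [q [wj q0 def_xz]]] :=
  im_mod_homog (hom_rowX (k := x) zj) (soc x (mem_head _ _)).
have lV' i : i \in l ++ x :: V.
  by have := lV i; rewrite cat_cons !(mem_cat, inE) orbCA.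
(* w is a cycle modulo x and V, and it is annihilated by the variables of l up to
   boundaries, because z is and because the complex is exact modulo V at w *)
have [||w' [q' [q'0 def_w]]] := IH (x :: V) t.+1 j.+1 w Ul' lV' def_T def_J van
                                  (exact_mod_cons xV ex) wj.
- have -> : w *m D t.+1 = 'X_x *: z - q by rewrite def_xz addrK.
  by apply: mod0B; [apply: mod0_X | apply: mod0_cons].
- move=> k kl; have [wk [qk [qk0 def_kz]]] := soc k (mem_behead (s := x :: l) kl).
  have [||u [p [p0 def_u]]] := ex t.+1 ('X_k *: w - 'X_x *: wk) => //.
    have -> : ('X_k *: w - 'X_x *: wk) *m D t.+1 = 'X_x *: qk - 'X_k *: q.
      have -> : q = 'X_x *: z - w *m D t.+1 by rewrite def_xz addrC addKr.
      have -> : qk = 'X_k *: z - wk *m D t.+1 by rewrite def_kz addrC addKr.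
      rewrite !scalerBr !scalerA [X in X *: z - _]mulrC mulmxBl -!scalemxAl.
      by rewrite opprB [RHS]addrC addrA subrK.
    by apply: mod0B; apply: mod0Z.
  exists u, (p + 'X_x *: wk); split.
    by apply: mod0D; [apply: mod0_cons | apply: mod0_X].
  by rewrite addrA -def_u subrK.
have [q1 [r [q10 def_q']]] := mod0_split q'0.
exists r, (z - r *m D t.+1); split; last by rewrite addrC subrK.
apply: (mod0_regular xV); rewrite scalerBr def_xz def_w def_q'.
rewrite !mulmxDl aug_comp add0r -scalemxAl addrAC addrK.
by apply: mod0D => //; apply: mod0M.
Qed.

Section Monomial.
Variable A : 'X_{1..n} -> Prop.
Hypothesis L_A : forall p, L p <-> supported A p.
Variable e : nat.
Hypothesis linF : forall i j, j != (i + e)%N -> Tor_eq0 F i j.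

Lemma mem_im_mod V (p : S) : L p -> im_mod V (i := 1) p%:M.
Proof.
move=> /(@gfr_aug_image _ _ _ F)[w def_p].
exists w, 0; split; first by move=> a; rewrite mxE; apply: supported0.
by rewrite addr0; apply/rowP => b; rewrite ord1 def_p mxE eqxx.
Qed.

Lemma im_mod_mem V (z : 'rV[S]_1) : im_mod V (i := 1) z ->
  exists2 q : 'rV_1, mod0 V q & L ((z - q) 0 0).
Proof.
case=> [w [q [q0 ->]]]; exists q => //; rewrite addrK.
by apply/(@gfr_aug_image _ _ _ F); exists w.
Qed.

(** If the complex stays exact modulo B, a monomial m outside L and prime to B that
    the other s variables multiply into L gives a nonzero class in
    Tor_(s-1)(L, K), of degree deg m + s; in a linear resolution this degree is
    s - 1 + e. *)
Lemma socle_degree B (m : 'X_{1..n}) :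
    exact_mod B 0 -> uniq B -> (size B < n)%N ->
    (forall i, i \in B -> m i = 0%N) -> ~ A m ->
    (forall k, k \notin B -> A (m + U_(k))%MM) ->
  (mdeg m).+1 = e.
Proof.
move=> exB uB szB mB nAm soc.
pose l := [seq i <- enum 'I_n | i \notin B].
have lB i : i \in l ++ B by rewrite mem_cat mem_filter mem_enum andbT orNb.
have uniq_lB : uniq (l ++ B).
  rewrite cat_uniq filter_uniq ?enum_uniq // uB andbT -all_predC.
  by apply/allP => i iB /=; rewrite mem_filter iB.
have sz_l : (0 < size l)%N.
  have : size (l ++ B) = n.
    by rewrite -(card_uniqP uniq_lB) -[RHS]card_ord; apply: eq_card.
  by rewrite size_cat => eqn; rewrite -(ltn_add2r (size B)) add0n eqn.
apply/eqP; apply: contra_notT nAm => ne_e.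
have van : tor_vanishes (size l) (mdeg m + size l).
  rewrite -{1}(prednK sz_l); apply: Tor_eq0_vanishes; apply: linF.
  by apply: contra ne_e => /eqP; lia.
have [|q q0] := @im_mod_mem B ('X_[m])%:M.
  apply: (annihilated_class_eq0 uniq_lB lB (esym (add0n _)) (erefl _) van exB).
  - by move=> a; rewrite ord1 mxE eqxx; apply: supportedX => /=; rewrite addn0.
  - by move=> [].
  - move=> k; rewrite mem_filter => /andP[kB _]; rewrite scale_scalar_mx.
    apply: mem_im_mod; apply/L_A; rewrite -mpolyXD addmC.
    by apply: supportedX; apply: soc.
move=> /L_A; apply; rewrite !mxE eqxx mcoeffB mcoeffX eqxx.
have -> : (q 0 0)@_m = 0; last by rewrite subr0 oner_eq0.
by apply/eqP; apply: contraT => /(q0 0)/hasP[i iB]; rewrite mB.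
Qed.

(** A linear resolution lives in the degree of the generators: a form of least
    degree in L is not a combination of elements of L with coefficients without
    constant terms, so that it gives a class in Tor_0. *)
Lemma initial_degree (m : 'X_{1..n}) :
  A m -> (forall m', A m' -> (mdeg m <= mdeg m')%N) -> e = mdeg m.
Proof.
move=> Am Amin; apply/eqP; apply: contraT => ne_e.
have Xm_hom : hom_row (mdeg m) (('X_[m])%:M : 'rV[S]_(rk 1)).
  by move=> a; rewrite ord1 mxE eqxx; apply: supportedX => /=; rewrite addn0.
have /(im_mod_homog Xm_hom)[w [q [wm q0 def_X]]] :
    im_mod [::] (('X_[m])%:M : 'rV[S]_(rk 1)).
  by apply: mem_im_mod; apply/L_A; apply: supportedX.
have Tor0 : Tor_eq0 F 0 (mdeg m) by apply: linF; rewrite eq_sym.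
have [//|w' [q' [q'0 def_w]]] := Tor_eq0_lift (@mem_enum _ _) Tor0 wm.
have def_Xm : 'X_[m] = (q' *m D 1) 0 0 + q 0 0.
  move/matrixP/(_ 0 0): def_X; rewrite def_w mulmxDl (aug_comp (i := 1)) add0r.
  by rewrite !mxE eqxx.
have q'D : supported (fun m' => mdeg m < mdeg m')%N ((q' *m D 1) 0 0).
  rewrite mxE; apply: supported_sum => a _.
  have aug_A : supported A (D 1 a 0).
    apply/L_A/(@gfr_aug_image _ _ _ F); exists (delta_mx 0 a).
    by rewrite -rowE mxE.
  apply: (supportedM (q'0 a) aug_A) => m1 m2 /hasP[i _ m1i] /Amin le_m2.
  rewrite mdegD -add1n leq_add //; rewrite lt0n mdeg_eq0.
  by apply: contraNneq m1i => ->; rewrite mnm0E.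
have : ('X_[m] : S)@_m != 0 by rewrite mcoeffX eqxx oner_eq0.
rewrite {1}def_Xm mcoeffD => nz; have [q'm|/q'D] := eqVneq ((q' *m D 1) 0 0)@_m 0.
  by move: nz; rewrite q'm add0r => /(q0 0).
by rewrite ltnn.
Qed.
End Monomial.
End Augmented.

(** * Monomial ideals with pure powers *)

Lemma ex_max_measure (T : Type) (P : T -> Prop) (f : T -> nat) b :
    (forall x, P x -> (f x <= b)%N) -> (exists x, P x) ->
  exists2 x, P x & forall y, P y -> (f y <= f x)%N.
Proof.
elim: b => [|b IH] Pb [x Px].
  by exists x => // y /Pb; rewrite leqn0 => /eqP->.
have [[y Py fy]|none] := classic (exists2 y, P y & f y = b.+1).
  by exists y => // z /Pb; rewrite fy.
apply: IH; last by exists x.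
move=> y Py; rewrite -ltnS ltn_neqAle Pb // andbT.
by apply/eqP => fy; apply: none; exists y.
Qed.

Section Ideals.
Variables (n : nat) (K : fieldType).
Local Notation S := {mpoly K[n]}.
Implicit Types (I J : S -> Prop) (M : 'X_{1..n} -> Prop) (C : {set 'I_n}).

Lemma ideal_span0 (G : S -> Prop) : ideal_span G 0.
Proof. by exists [::]; rewrite big_nil. Qed.

Lemma ideal_spanD (G : S -> Prop) p q :
  ideal_span G p -> ideal_span G q -> ideal_span G (p + q).
Proof.
move=> [s [sG ->]] [t [tG ->]]; exists (s ++ t); rewrite big_cat; split=> // c.
by rewrite mem_cat => /orP[/sG|/tG].
Qed.

Lemma ideal_spanM (G : S -> Prop) p q : G q -> ideal_span G (p * q).
Proof.
by exists [:: (p, q)]; rewrite big_seq1; split=> // c; rewrite inE => /eqP->.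
Qed.

Lemma ideal_span_supported (G : S -> Prop) M :
    (forall q, G q -> supported (fun m => exists2 u, M u & (u <= m)%MM) q) ->
    (forall u, M u -> G 'X_[u]) ->
  forall p, ideal_span G p <-> supported (fun m => exists2 u, M u & (u <= m)%MM) p.
Proof.
move=> GM MG p; split=> [[s [sG ->]]|Mp].
  rewrite big_seq; apply: supported_sum => c /sG/GM cM.
  apply: (supportedM (P := fun=> True) _ cM) => // m1 m2 _ [u Mu le_u].
  by exists u => //; apply: lepm_trans le_u (lem_addl _ _).
rewrite [p]mpolyE big_seq; apply: (big_ind (ideal_span G)).
- exact: ideal_span0.
- exact: ideal_spanD.
move=> m; rewrite mcoeff_msupp => /Mp[u Mu le_u].
rewrite -(submK le_u) mpolyXD scalerAl; exact/ideal_spanM/MG.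
Qed.

Lemma monomial_spanP M (p : S) :
  monomial_span M p <-> supported (fun m => exists2 u, M u & (u <= m)%MM) p.
Proof.
apply: ideal_span_supported => [q [u Mu ->]|u Mu]; last by exists u.
by apply: supportedX; exists u => //; apply: lepm_refl.
Qed.

Definition drop_mnm C (m : 'X_{1..n}) : 'X_{1..n} :=
  [multinom if i \in C then 0%N else m i | i < n].

Lemma drop_mnmE C m i : drop_mnm C m i = if i \in C then 0%N else m i.
Proof. exact: mnmE. Qed.

Lemma drop_mnmP C u m :
  (drop_mnm C u <= m)%MM <-> (forall i, i \notin C -> (u i <= m i)%N).
Proof.
split=> [/mnm_lepP le i /negbTE iC|le].
  by have := le i; rewrite drop_mnmE iC.
by apply/mnm_lepP => i; rewrite drop_mnmE; case: ifP => // /negbT/le.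
Qed.

Lemma mdeg_drop1 x m : mdeg (drop_mnm [set x] m) = (mdeg m - m x)%N.
Proof.
suff : (mdeg (drop_mnm [set x] m) + m x = mdeg m)%N by move=> <-; rewrite addnK.
rewrite !mdegE (bigD1 x) //= [RHS](bigD1 x) //= drop_mnmE inE eqxx add0n addnC.
by congr addn; apply: eq_bigr => i; rewrite drop_mnmE inE => /negbTE->.
Qed.

Lemma comp_drop_mnm C m :
  'X_[m] \mPo [tuple if i \in C then 1 else 'X_i | i < n]
  = 'X_[drop_mnm C m] :> S.
Proof.
rewrite comp_mpolyX mpolyXE_id; apply: eq_bigr => i _.
by rewrite tnth_mktuple drop_mnmE; case: ifP; rewrite ?expr1n ?expr0.
Qed.

(** The substitution deletes the variables in C from a monomial. *)
Lemma mon_locP I C :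
    (forall p, I p <-> supported (fun m => I 'X_[m]) p) ->
  forall p, mon_loc I C p <->
    supported (fun m => exists2 u, I 'X_[u]
                         & forall i, i \notin C -> (u i <= m i)%N) p.
Proof.
move=> Isupp p.
have span := @ideal_span_supported (fun q => exists2 p, I p &
    q = p \mPo [tuple if i \in C then 1 else 'X_i | i < n])
  (fun w => exists2 u, I 'X_[u] & w = drop_mnm C u).
rewrite /mon_loc span => [|q [r Ir ->]|w [u Iu ->]].
- apply: eq_supported => m; split.
    by case=> _ [u Iu ->] /drop_mnmP; exists u.
  by case=> u Iu /drop_mnmP le; exists (drop_mnm C u) => //; exists u.
- rewrite comp_mpolyEX big_seq; apply: supported_sum => m.
  rewrite mcoeff_msupp comp_drop_mnm => rm; apply: supportedZ; apply: supportedX.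
  exists (drop_mnm C m); last exact: lepm_refl.
  by exists m => //; move/Isupp: Ir => /(_ _ rm).
by exists 'X_[u] => //; rewrite comp_drop_mnm.
Qed.

Lemma linear_resolution_eq I J :
  eq_ideal I J -> linear_resolution I -> linear_resolution J.
Proof.
move=> eqIJ [[rk dg df aug dfh augh augI ex0 exS] [e lin]].
have augJ p : J p <-> exists v : 'rV_(rk 0), p = (v *m aug) 0 0.
  by rewrite -(eqIJ p) augI.
by exists (GradedFreeResolution dfh augh augJ ex0 exS), e.
Qed.

End Ideals.

Lemma mdeg_one_variable n (m : 'X_{1..n.+1}) : n = 0%N -> mdeg m = m ord_max.
Proof.
move=> n0; rewrite mdegE (bigD1 ord_max) //= big1 ?addn0 // => i /eqP[].
by apply: val_inj => /=; have := ltn_ord i; lia.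
Qed.

Section MonomialIdeal.
Variables (K : fieldType) (n d : nat) (I : {mpoly K[n.+1]} -> Prop).
Hypothesis I_mon : monomial_ideal I.
Hypothesis I_deg : generated_in_degree I d.
Hypothesis I_neq0 : d = 0%N -> exists2 p, I p & p != 0.
Hypothesis I_pow : forall i : 'I_n.+1, i != ord_max -> I ('X_i ^+ d).
Local Notation A := (fun m => I 'X_[m]).
Implicit Types (u v m : 'X_{1..n.+1}).

Lemma monomial_ideal_supported p : I p <-> supported A p.
Proof.
have [M IM] := I_mon.
have AM m : A m <-> exists2 u, M u & (u <= m)%MM.
  rewrite (IM 'X_[m]) monomial_spanP; split=> [|Mm]; last exact: supportedX.
  by apply; rewrite mcoeffX eqxx oner_neq0.
by rewrite (IM p) monomial_spanP; apply: eq_supported => m; rewrite AM.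
Qed.

Lemma monomial_ideal_up u m : A u -> (u <= m)%MM -> A m.
Proof.
move=> Au le_um; apply/monomial_ideal_supported; apply: supportedX.
have [M IM] := I_mon; apply/IM/monomial_spanP; apply: supportedX.
move/IM/monomial_spanP: Au => /(_ u); rewrite mcoeffX eqxx oner_neq0.
by case=> // w Mw le_w; exists w => //; apply: lepm_trans le_um.
Qed.

Lemma generator_below m : A m -> exists2 u, A u /\ mdeg u = d & (u <= m)%MM.
Proof.
move=> Am; suff [u mu le_u] : exists2 u, min_gens I u & (u <= m)%MM.
  by exists u => //; split; [case: mu | apply: I_deg].
elim: {m}(mdeg m).+1 {-2}m (ltnSn (mdeg m)) Am => // b IH m le_b Am.
have [[v [Av le_v ne]]|none] := classic (exists v, [/\ A v, (v <= m)%MM & v <> m]).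
  have [|u mu le_u] := IH v _ Av; last by exists u => //; apply: lepm_trans le_v.
  rewrite -ltnS; apply: leq_trans le_b; rewrite ltnS ltn_neqAle lem_mdeg // andbT.
  by apply/eqP => eqd; apply: ne; apply: lem_mdeg_eq.
exists m; last exact: lepm_refl.
split=> // v Av le_v; have [//|ne] := classic (v = m).
by case: none; exists v.
Qed.

Lemma degree_ge m : A m -> (d <= mdeg m)%N.
Proof. by case/generator_below => u [_ <-] /lem_mdeg. Qed.

Lemma min_gens_of_degree u : A u -> mdeg u = d -> min_gens I u.
Proof.
move=> Au du; split=> // v Av le_v; apply: lem_mdeg_eq => //.
by apply/eqP; rewrite eqn_leq lem_mdeg //= du degree_ge.
Qed.

Lemma pure_power_mem i : i != ord_max -> A (U_(i) *+ d)%MM.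
Proof. by move=> /I_pow; rewrite mpolyXn. Qed.

Lemma large_exponent_mem i m : i != ord_max -> (d <= m i)%N -> A m.
Proof.
move=> i_max le_d; apply: monomial_ideal_up (pure_power_mem i_max) _.
apply/mnm_lepP => j.
by rewrite mulmnE mnm1E; case: eqP => [<-|]; rewrite ?mul1n ?mul0n.
Qed.

(** The condition that the ideal be of Veronese type, expressed by the monomials
    of degree d alone. *)
Definition veronese_upto k := forall u, mdeg u = d -> (A u <-> (u ord_max <= k)%N).

Lemma veronese_upto_monomial k m :
  veronese_upto k -> A m <-> veronese_monomial d k m.
Proof.
move=> ver; split=> [/generator_below[u [Au du] le_u]|[u [du uk le_u]]].
  by exists u; split=> //; apply/(ver u du).
by apply: monomial_ideal_up le_u; apply/(ver u du).
Qed.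

Local Notation bound k := (fun i : 'I_n.+1 => if i == ord_max then k else d).

Lemma veronese_type_supported k (p : {mpoly K[n.+1]}) :
  veronese_type d (bound k) p <-> supported (veronese_monomial d k) p.
Proof.
rewrite /veronese_type monomial_spanP; apply: eq_supported => m; split.
  by case=> u [du uk] le_u; exists u; split=> //; have := uk ord_max; rewrite eqxx.
case=> u [du uk le_u]; exists u => //; split=> // i; case: eqP => [->//|_].
by rewrite -du mdegE (bigD1 i) //= leq_addr.
Qed.

Lemma veronese_upto_type k :
  veronese_upto k <-> eq_ideal I (veronese_type d (bound k)).
Proof.
split=> [ver p|eqI u du].
  rewrite veronese_type_supported monomial_ideal_supported.
  by apply: eq_supported => m; apply: veronese_upto_monomial.
rewrite (eqI 'X_[u]) veronese_type_supported.
split=> [/(_ u)|uk]; last first.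
  by apply: supportedX; exists u; split=> //; apply: lepm_refl.
rewrite mcoeffX eqxx oner_neq0 => /(_ isT)[w [dw wk le_w]].
by rewrite -(lem_mdeg_eq le_w) // dw du.
Qed.

(** Without generators there is a single variable and d > 0: this zero
    ideal is of Veronese type with k = 0. *)
Lemma veronese_or_max_generator :
  veronese_upto 0 \/
  exists v, [/\ A v, mdeg v = d
    & forall u, A u -> mdeg u = d -> (u ord_max <= v ord_max)%N].
Proof.
have [ex|none] := classic (exists u, A u /\ mdeg u = d).
  have [|v [Av dv] vmax] := @ex_max_measure _ (fun u => A u /\ mdeg u = d)
                              (fun u => u ord_max) d _ ex.
    by move=> u [_ <-]; rewrite mdegE (bigD1 ord_max) //= leq_addr.
  by right; exists v; split=> // u Au du; apply: vmax.
have n0 : n = 0%N.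
  case: (posnP n) => // n_gt0; case: none.
  have ne : ord0 != ord_max :> 'I_n.+1 by rewrite -val_eqE /=; lia.
  exists (U_(ord0) *+ d)%MM; split; first exact: pure_power_mem.
  by rewrite mdegMn mdeg1 mul1n.
left=> u du; split=> [Au|]; first by case: none; exists u.
rewrite -mdeg_one_variable // du leqn0 => /eqP d0.
have [p Ip] := I_neq0 d0; rewrite -msupp_eq0.
case def_p: (msupp p) => [|m s] // _.
case: none; have [|w Aw _] := @generator_below m; last by exists w.
by move/monomial_ideal_supported: Ip; apply; rewrite -mcoeff_msupp def_p mem_head.
Qed.

(** An exchange with x_i^d replaces any variable of a generator by x_i. Let v be a
    generator with the largest exponent of the last variable. A monomial of degree
    d in which this exponent is at most as large exceeds v in other variables
    only, so that such replacements lead from v to it. *)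
Lemma polymatroidal_veronese : polymatroidal I -> exists k, veronese_upto k.
Proof.
move=> [_ _ exch].
have [|[v [Av dv vmax]]] := veronese_or_max_generator; first by exists 0%N.
exists (v ord_max) => u du; split=> [Au|le_uv]; first exact: vmax.
pose dist w := (\sum_i (w i - u i))%N.
elim: {v}(dist v).+1 {-2}v (ltnSn (dist v)) Av dv le_uv {vmax} => // b IH v.
move=> le_b Av dv le_uv.
have [<- //|ne] := eqVneq v u.
have [l lt_l] : exists l, (u l < v l)%N.
  apply/existsP; apply: contraNT ne => /existsPn le.
  apply/eqP/lem_mdeg_eq; rewrite ?dv //.
  by apply/mnm_lepP => i; rewrite leqNgt.
have [i lt_i] : exists i, (v i < u i)%N.
  apply/existsP; apply: contraNT ne => /existsPn le.
  apply/eqP/esym/lem_mdeg_eq; rewrite ?dv //.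
  by apply/mnm_lepP => j; rewrite leqNgt.
have i_max : i != ord_max by apply: contraTneq lt_i => ->; rewrite -leqNgt.
have il : i != l by apply: contraTneq lt_i => ->; rewrite -leqNgt ltnW.
(* x_i is the only variable that can be gained in an exchange with x_i^d *)
have [||j] := exch v (U_(i) *+ d)%MM (min_gens_of_degree Av dv) _ l.
- apply: min_gens_of_degree; first exact: pure_power_mem.
  by rewrite mdegMn mdeg1 mul1n.
- by rewrite mulmnE mnm1E (negbTE il) mul0n (leq_ltn_trans _ lt_l).
rewrite mulmnE mnm1E; have [<- _ Aw|] := eqVneq i j; last by rewrite mul0n.
have le_lv : (U_(l) <= v)%MM by rewrite lep1mP -lt0n (leq_ltn_trans _ lt_l).
have wE j' : ((v - U_(l) + U_(i))%MM j' = v j' - (l == j') + (i == j'))%N.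
  by rewrite mnmDE mnmBE !mnm1E.
apply: (IH _ _ Aw).
- rewrite -ltnS; apply: leq_trans le_b; rewrite ltnS /dist.
  rewrite (bigD1 l) //= [X in (_ < X)%N](bigD1 l) //= wE eqxx (negbTE il) addn0.
  rewrite -addSn leq_add //; first by lia.
  apply: leq_sum => j' jl; rewrite wE eq_sym (negbTE jl) subn0.
  by have [<-|_] := eqVneq i j'; rewrite ?addn0 //; lia.
- have := congr1 mdeg (submK le_lv); rewrite !mdegD !mdeg1 dv => <-; lia.
rewrite wE; have [eql|_] := eqVneq l ord_max; last by lia.
by move: lt_l; rewrite eql; lia.
Qed.

Lemma veronese_polymatroidal k : veronese_upto k -> polymatroidal I.
Proof.
clear I_neq0 I_pow.
move=> ver; split=> [//||u v mu mv i lt_i]; first by exists d.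
have [[Au _] [Av _]] := (mu, mv); have du := I_deg mu; have dv := I_deg mv.
have uk : (u ord_max <= k)%N by apply/(ver u du).
have vk : (v ord_max <= k)%N by apply/(ver v dv).
have [j lt_j] : exists j, (u j < v j)%N.
  apply/existsP; apply: contraTT lt_i => /existsPn le.
  have -> : v = u; last by rewrite ltnn.
  apply: lem_mdeg_eq; rewrite ?du //.
  by apply/mnm_lepP => j; rewrite leqNgt.
have le_iu : (U_(i) <= u)%MM by rewrite lep1mP -lt0n (leq_ltn_trans _ lt_i).
exists j => //.
apply/ver.
  by have := congr1 mdeg (submK le_iu); rewrite !mdegD !mdeg1 du.
rewrite mnmDE mnmBE !mnm1E; have [eqj|_] := eqVneq j ord_max; last by lia.
by move: lt_j; rewrite eqj; lia.
Qed.

(** If a variable other than the last one is inverted, then so is its dth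
    power and the localization is the unit ideal. If only the last one is, then
    the generators lose up to k of their factors, which leaves all monomials of
    degree d - k in the other variables. *)
Lemma veronese_localization k C : veronese_upto k -> exists d' k',
  forall p, mon_loc I C p <-> supported (veronese_monomial d' k') p.
Proof.
move=> ver.
suff [d' [k' H]] : exists d' k', forall m,
    (exists2 u, A u & forall i, i \notin C -> (u i <= m i)%N)
    <-> veronese_monomial d' k' m.
  exists d', k' => p; rewrite (mon_locP _ monomial_ideal_supported).
  by apply: eq_supported.
have [[i [iC i_max]]|none] := classic (exists i, i \in C /\ i != ord_max).
  exists 0%N, 0%N => m; split=> _.
    exists 0%MM; rewrite mdeg0 mnm0E; split=> //.
    by apply/mnm_lepP => j; rewrite mnm0E.
  exists (U_(i) *+ d)%MM => [|j jC]; first exact: pure_power_mem.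
  rewrite mulmnE mnm1E; case: eqP jC => [<-|]; first by rewrite iC.
  by rewrite mul0n.
have memC i : i \in C -> i = ord_max.
  by move=> iC; apply/eqP; apply: contraT => ne; case: none; exists i.
have [maxC|maxNC] := boolP (ord_max \in C); last first.
  exists d, k => m; rewrite -(veronese_upto_monomial m ver); split=> [[u Au le]|Am].
    apply: monomial_ideal_up Au _; apply/mnm_lepP => i; apply: le.
    by apply: contra maxNC => iC; rewrite -(memC i iC).
  by exists m.
have defC i : (i \in C) = (i == ord_max).
  by apply/idP/eqP => [/memC|->].
exists (d - k)%N, 0%N => m; split=> [[u Au le_um]|[w [dw w0 le_w]]].
  have [v [Av dv] le_vu] := generator_below Au.
  have vk : (v ord_max <= k)%N by apply/(ver v dv).
  have [|w le_w dw] := @mdeg_divisor _ (d - k) (drop_mnm [set ord_max] v).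
    by rewrite mdeg_drop1 dv leq_sub2l.
  have le i : (w i <= if i == ord_max then 0 else m i)%N.
    move/mnm_lepP/(_ i): le_w; rewrite drop_mnmE inE; case: ifP => // nmax le_w.
    apply: leq_trans le_w _; apply: leq_trans (le_um i _); last first.
      by rewrite defC nmax.
    exact/mnm_lepP.
  exists w; split=> //; first by have := le ord_max; rewrite eqxx.
  by apply/mnm_lepP => i; have := le i; case: ifP => // _; rewrite leqn0 => /eqP->.
exists (w + U_(ord_max) *+ minn k d)%MM.
  apply/ver.
    by rewrite mdegD mdegMn mdeg1 mul1n dw minnC minnE subnKC ?leq_subr.
  move: w0; rewrite leqn0 mnmDE mulmnE mnm1E eqxx mul1n => /eqP->.
  exact: geq_minl.
move=> i; rewrite defC mnmDE mulmnE mnm1E eq_sym => /negbTE->; rewrite addn0.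
exact/mnm_lepP.
Qed.

(** Let k be the largest exponent of the last variable in a generator. The
    localization has initial degree d - k and contains powers of the other
    variables, so that by socle_degree it contains all monomials of degree d - k in
    these variables. Hence a monomial of degree at least d - k in the other
    variables belongs to I if its exponent of the last one is at least k. If
    some monomial of degree at least d with an exponent of at most k is missing,
    then there is a missing one of largest degree, every variable multiplies it
    into I, and its degree contradicts socle_degree for I itself. *)
Lemma linear_veronese :
  linear_resolution I -> linear_resolution (mon_loc I [set ord_max]) ->
  exists k, veronese_upto k.
Proof.
move=> [F1 [e1 lin1]] [F2 [e2 lin2]].
have [|[v [Av dv vmax]]] := veronese_or_max_generator; first by exists 0%N.
set k := v ord_max in vmax.
exists k => u du; split=> [Au|le_uk]; first exact: vmax.
have [n0|n_gt0] := posnP n.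
  suff -> : u = v by [].
  apply/mnmP => i; have -> : i = ord_max.
    by apply: val_inj => /=; have := ltn_ord i; lia.
  by rewrite -!mdeg_one_variable // du dv.
(* the monomials of the localization *)
pose LA m := exists2 u, A u & forall i, i \notin [set ord_max] -> (u i <= m i)%N.
have L_LA := mon_locP [set ord_max] monomial_ideal_supported; rewrite -/LA in L_LA.
have def_e1 : e1 = d.
  rewrite -dv; apply: (initial_degree monomial_ideal_supported lin1) => // m.
  by move=> /degree_ge; rewrite dv.
have LA_gen m : LA m -> exists w, [/\ A w, mdeg w = d, (w ord_max <= k)%N
    & forall i, i != ord_max -> (w i <= m i)%N].
  case=> w Aw le_wm; have [w' [Aw' dw'] le_w'] := generator_below Aw.
  exists w'; split=> // [|i nmax]; first exact: vmax.
  by apply: leq_trans (le_wm i _); [apply/mnm_lepP | rewrite inE].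
have def_e2 : e2 = (d - k)%N.
  have -> : (d - k)%N = mdeg (drop_mnm [set ord_max] v).
    by rewrite mdeg_drop1 dv.
  apply: (initial_degree L_LA lin2).
    by exists v => // i /negbTE iC; rewrite drop_mnmE iC.
  move=> m /LA_gen[w [_ dw wk le_wm]].
  have : (mdeg (drop_mnm [set ord_max] w) <= mdeg m)%N.
    by apply/lem_mdeg/drop_mnmP => i; rewrite inE; apply: le_wm.
  by rewrite !mdeg_drop1 dv dw; apply: leq_trans; apply: leq_sub2l.
(* otherwise a monomial of largest degree among the missing ones violates
   socle_degree *)
have LA_full m : m ord_max = 0%N -> (d - k <= mdeg m)%N -> LA m.
  move=> m0 dm; apply: NNPP => nLA.
  pose P m := [/\ m ord_max = 0%N, (d - k <= mdeg m)%N & ~ LA m].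
  have [|w [w0 dw nw] wmax] := @ex_max_measure _ P mdeg (n.+1 * d) _
                                 (ex_intro _ m (And3 m0 dm nLA)).
    move=> w [w0 _ nw]; rewrite mdegE -[X in (_ <= X * _)%N]card_ord -sum_nat_const.
    apply: leq_sum => i _; have [->|nmax] := eqVneq i ord_max.
      by rewrite w0.
    rewrite leqNgt; apply/negP => lt; apply: nw; exists w => //.
    exact: (large_exponent_mem nmax (ltnW lt)).
  have reg p :
      mon_loc I [set ord_max] ('X_ord_max * p) -> mon_loc I [set ord_max] p.
    rewrite !L_LA => Xp m' /(mcoeff_neq0_mulX ord_max)/Xp[z Az le_z].
    exists z => // i iC; have := le_z i iC; rewrite mnmDE mnm1E.
    by move: iC; rewrite inE eq_sym => /negbTE->; rewrite addn0.
  have := socle_degree L_LA lin2 (exact_mod_cons0 reg) (m := w).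
  rewrite def_e2 => /(_ isT n_gt0) soc.
  suff : (mdeg w).+1 = (d - k)%N by lia.
  apply: soc => // [i|i]; rewrite inE; first by move/eqP->.
  move=> nmax; apply: NNPP => nLAi.
  have : (mdeg (w + U_(i))%MM <= mdeg w)%N.
    apply: wmax; split=> //; last by rewrite mdegD mdeg1; lia.
    by rewrite mnmDE mnm1E w0 (negbTE nmax).
  by rewrite mdegD mdeg1; lia.
apply: NNPP => nAu.
pose P m := [/\ ~ A m, (d <= mdeg m)%N & (m ord_max <= k)%N].
have Pu : P u by split=> //; rewrite du.
have [|w [nAw dw wk] wmax] :=
    @ex_max_measure _ P mdeg (n.+1 * (d + k)) _ (ex_intro _ u Pu).
  move=> w [nw _ wk]; rewrite mdegE -[X in (_ <= X * _)%N]card_ord -sum_nat_const.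
  apply: leq_sum => i _; have [->|nmax] := eqVneq i ord_max; first by lia.
  rewrite leqNgt; apply/negP => lt; apply: nw.
  by apply: (large_exponent_mem nmax); lia.
(* if x_n has the exponent k in w, then w is in I because its part prime to x_n
   is in the localization *)
have lt_wk : (w ord_max < k)%N.
  rewrite ltn_neqAle wk andbT; apply/eqP => eqk; apply: nAw.
  have [|z [Az dz zk le_z]] := @LA_gen (drop_mnm [set ord_max] w).
    apply: LA_full; first by rewrite drop_mnmE inE eqxx.
    by rewrite mdeg_drop1 eqk leq_sub2r.
  apply: monomial_ideal_up Az _; apply/mnm_lepP => i.
  have [->|nmax] := eqVneq i ord_max.
    by rewrite eqk.
  by have := le_z i nmax; rewrite drop_mnmE inE (negbTE nmax).
have := socle_degree monomial_ideal_supported lin1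
          (@exact_mod_nil _ _ _ F1) (m := w) isT isT.
rewrite def_e1 => soc; suff : (mdeg w).+1 = d by lia.
apply: soc => // i _; apply: NNPP => nAi.
have : (mdeg (w + U_(i))%MM <= mdeg w)%N.
  apply: wmax; split=> //; first by rewrite mdegD; lia.
  by rewrite mnmDE mnm1E; lia.
by rewrite mdegD mdeg1; lia.
Qed.

Lemma mon_loc_set0 : eq_ideal (mon_loc I set0) I.
Proof.
move=> p; rewrite (mon_locP _ monomial_ideal_supported) monomial_ideal_supported.
apply: eq_supported => m; split; last by exists m.
case=> u Au le; apply: monomial_ideal_up Au _; apply/mnm_lepP => i.
by apply: le; rewrite inE.
Qed.

End MonomialIdeal.

Theorem proposition2p4 (K : fieldType) (n d : nat)
    (I : {mpoly K[n.+1]} -> Prop)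
    (I_mon : monomial_ideal I)
    (I_deg : generated_in_degree I d)
    (I_neq0 : d = 0%N -> exists2 p, I p & p != 0)
    (I_pow : forall i : 'I_n.+1, i != ord_max -> I ('X_i ^+ d)) :
  [<-> polymatroidal I;
       forall C : {set 'I_n.+1}, linear_resolution (mon_loc I C);
       linear_resolution I /\ linear_resolution (mon_loc I [set ord_max]);
       exists k : nat,
         eq_ideal I (veronese_type d (fun i => if i == ord_max then k else d))].
Proof.
tfae=> [pI C | linI | [linI linJ] | [k eqI]].
- have [k ver] := polymatroidal_veronese I_mon I_deg I_neq0 I_pow pI.
  have [d' [k' locI]] := veronese_localization I_mon I_deg I_pow C ver.
  exact: veronese_linear_resolution locI.
- by split=> //; apply: linear_resolution_eq (mon_loc_set0 I_mon) _.
- have [k ver] := linear_veronese I_mon I_deg I_neq0 I_pow linI linJ.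
  by exists k; apply/(veronese_upto_type I_mon I_deg).
by apply: (veronese_polymatroidal I_mon I_deg (k := k)); apply/veronese_upto_type.
Qed.
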